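(* Let $m>0$, $K>0$, $r>0$, $T>1$. There exists a constant $C=C(T,m,K,r)>0$, independent of $h$, with the following property. Let $N\in\mathbb N$, $h=1/(N+1)$, let $p_h\in L^\infty_{h,\le m}(0,1)$ and let $(y_h^0,y_h^1)$, $g_h\in L^1(0,T;L_h^2(0,1))$, $g_h^0,g_h^1\in L^2(0,T)$ be data such that the solution $y_h[p_h]$ of the semi-discrete wave equation with potential $p_h$ satisfies $$\|y_h[p_h]\|_{H^1(0,T;L_h^\infty(0,1))}\le K\qquad\text{and}\qquad \inf_{1\le j\le N}|y^0_{j,h}|\ge r .$$ Then for all $q_h\in L^\infty_{h,\le m}(0,1)$, $$\|q_h-p_h\|_{L_h^2(0,1)}\le C\,\big\|\partial_t(\partial_h^-y_h[q_h])_{N+1}-\partial_t(\partial_h^-y_h[p_h])_{N+1}\big\|_{L^2(0,T)}+C\,\big\|h\,\partial_h^+\partial_{tt}y_h[q_h]-h\,\partial_h^+\partial_{tt}y_h[p_h]\big\|_{L^2(0,T;L_h^2([0,1)))}.$$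
   Context: For $N\in\mathbb N$ put $h=1/(N+1)$, $x_j=jh$. For discrete functions: $(\Delta_hv)_j=(v_{j+1}-2v_j+v_{j-1})/h^2$, $(\partial_h^+v)_j=(\partial_h^-v)_{j+1}=(v_{j+1}-v_j)/h$. Norms: $\|f\|^2_{L_h^2(0,1)}=h\sum_{j=1}^N|f_j|^2$, $\|f\|^2_{L_h^2([0,1))}=h\sum_{j=0}^N|f_j|^2$, $\|f\|_{L_h^\infty(0,1)}=\sup_{1\le j\le N}|f_j|$. $L^\infty_{h,\le m}(0,1)=\{q_h=(q_{j,h})_{1\le j\le N}:\|q_h\|_{L_h^\infty(0,1)}\le m\}$. For a potential $q_h=(q_{j,h})_{1\le j\le N}$, $y_h[q_h]=(y_{j,h}(t))_{0\le j\le N+1}$ denotes the solution of $$\partial_{tt}y_{j,h}-(\Delta_hy_h)_j+q_{j,h}y_{j,h}=g_{j,h}\ \ (t\in(0,T),\ 1\le j\le N),$$ $$y_{0,h}(t)=g_h^0(t),\quad y_{N+1,h}(t)=g_h^1(t),\qquad y_{j,h}(0)=y^0_{j,h},\quad \partial_ty_{j,h}(0)=y^1_{j,h}\ \ (1\le j\le N).$$ The data $(y_h^0,y_h^1),g_h,(g_h^0,g_h^1)$ are the same for $p_h$ and $q_h$, so $y_h[q_h]-y_h[p_h]$ vanishes at $j=0$ and $j=N+1$; the differences on the right-hand side of the estimate are the corresponding expressions applied to $y_h[q_h]-y_h[p_h]$. *)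

(* Defs.v *)
From HB Require Import structures.
From mathcomp Require Import all_boot all_order all_algebra.
From mathcomp Require Import all_classical all_reals all_analysis.
Import Order.TTheory GRing.Theory Num.Theory.
Import numFieldNormedType.Exports.

Set Implicit Arguments.
Unset Strict Implicit.
Unset Printing Implicit Defensive.

Local Open Scope classical_set_scope.
Local Open Scope ring_scope.

(* Discrete functions on the grid x_j = j * h, h = 1 / (N + 1), are sequences
   [v : nat -> R] of which only the values at 0 <= j <= N + 1 (or, for
   potentials, sources and initial data, at 1 <= j <= N) are ever used.
   Time-dependent ones are [y : nat -> R -> R], so that [y ^~ t] is the
   discrete function at time [t]. *)

Section discrete.
Context {R : realType} (N : nat).
Implicit Types (v : nat -> R) (j : nat).

Definition hstep : R := N.+1%:R^-1.

Definition laplh v j : R := (v j.+1 - 2 * v j + v j.-1) / hstep ^+ 2.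

Definition dplush v j : R := (v j.+1 - v j) / hstep.

Definition dminush v j : R := (v j - v j.-1) / hstep.

(* L_h^2(0,1): the sum is over 1 <= j <= N *)
Definition L2h v : R :=
  Num.sqrt (hstep * \sum_(1 <= j < N.+1) `|v j| ^+ 2).

(* L_h^2([0,1)): the sum is over 0 <= j <= N *)
Definition L2h0 v : R :=
  Num.sqrt (hstep * \sum_(0 <= j < N.+1) `|v j| ^+ 2).

Definition Linfh v : R := \big[Num.max/0]_(1 <= j < N.+1) `|v j|.

End discrete.
Arguments hstep R N : clear implicits.

Section time.
Context {R : realType}.
Notation mu := (@lebesgue_measure R).
Implicit Types (T : R) (f u v : R -> R) (g y : nat -> R -> R).

Definition normL2t T f : \bar R := 'N[mu]_2%:E[EFin \o (f \_ `]0, T[)].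

Definition inL2t T f : Prop :=
  measurable_fun `]0, T[ f /\ (normL2t T f < +oo)%E.

Definition inL1L2h N T g : Prop :=
  (forall j, (1 <= j <= N)%N -> measurable_fun `]0, T[ (g j)) /\
  (\int[mu]_(t in `]0%R, T[) (L2h N (g ^~ t))%:E < +oo)%E.

(* In H^1(0,T; L_h^oo(0,1)) only the components 1 <= j <= N matter.  For a
   solution in the sense of [is_solution] these are C^1 on ]0, T[, so their
   weak time derivative is the classical one. *)
Definition normH1Linfh N T y : \bar R :=
  ((normL2t T (fun t => Linfh N (y ^~ t)) `^ 2 +
    normL2t T (fun t => Linfh N (fun j => derive1 (y j) t)) `^ 2) `^ 2^-1)%E.

(* u is (the continuous representative of) an element of W^{1,1}(0,T), with
   derivative v: it is the indefinite integral of the integrable function v *)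
Definition W11_derivative T u v : Prop :=
  mu.-integrable `[0, T] (EFin \o v) /\
  (forall t, t \in `[0, T] -> u t = u 0 + \int[mu]_(s in `[0, t]) v s).

(* Caratheodory solution of the semi-discrete wave equation: since
   g_h is in L^1(0,T; L_h^2) and the boundary data are in L^2(0,T), each
   interior component is in W^{2,1}(0,T), with ydot = y_j' and yddot = y_j'',
   and the equation holds almost everywhere.  The components 0 and N + 1 are
   the given representatives g0, g1 of the boundary data. *)
Definition is_solution N T (q y0 y1 : nat -> R) g (g0 g1 : R -> R) y : Prop :=
  [/\ forall t, t \in `[0, T] -> y 0%N t = g0 t,
      forall t, t \in `[0, T] -> y N.+1 t = g1 t &
      forall j, (1 <= j <= N)%N ->
        exists ydot yddot : R -> R,
          [/\ W11_derivative T (y j) ydot, W11_derivative T ydot yddot,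
              y j 0 = y0 j, ydot 0 = y1 j &
              {ae mu, forall t, t \in `]0, T[ ->
                 yddot t - laplh N (y ^~ t) j + q j * y j t = g j t}]].

End time.

(* Main.v *)
(* The difference z = y[q] - y[p] is studied through w = z', whose initial data
   are w(0) = 0 and w'(0) = (p - q) y^0, so that |w'_j(0)| >= r |q_j - p_j|.
   With a_j = (w_{j+1} - w_j) / h, b = w' and the weights om_j = (1 + lam h)^j, a
   discrete e^{lam x}, the functional
     F = h sum_j om_j ((b_j^2 + a_j^2) / 2 - b_j (a_j + a_{j-1}) - w_j^2)
   is such that e^{- kap lam t} F decreases, for kap < 1, at most by the observed
   flux a_N^2, the viscosity term (b_{j+1} - b_j)^2 and O(1/lam) times the
   weighted norm of q - p: this plays the role of a Carleman estimate.  At t = 0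
   it dominates that weighted norm; at t = T it is at most
   e^{- lam (kap T - 1)} times the energy, itself O(|q - p|^2).  As T > 1, one can
   take kap T > 1 and conclude with lam large.  This requires lam h small; for the
   remaining finitely many N, the viscosity term alone controls all the b_j and
   (T - t) sum_j (b_j^2 / 2 - 19 w_j^2) is used instead. *)

Require Import Defs.
From HB Require Import structures.
From mathcomp Require Import all_boot all_order all_algebra.
From mathcomp Require Import all_classical all_reals all_analysis.
From mathcomp Require Import measurable_realfun zify ring lra.
Import Order.TTheory GRing.Theory Num.Theory.
Import numFieldNormedType.Exports.
Local Open Scope classical_set_scope.
Local Open Scope ring_scope.

(** * Differentiable functions on a time interval *)

Section diff_on.
Context {R : realType} {T : R}.
Implicit Types u v du dv : R -> R.

(** Continuity up to the end points together with a derivative inside is what a mean value argument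
    needs. At 0 and T the two-sided derivative depends on values outside the interval, so [du] is
    left free there. *)
Definition diff_on u du :=
  {within `[0, T], continuous u} /\
  (forall t, t \in `]0, T[ -> is_derive t 1 u (du t)).

Lemma within_ext u v : {in `[0, T], u =1 v} ->
  {within `[0, T], continuous u} -> {within `[0, T], continuous v}.
Proof.
move=> uv cu; apply: (subspace_eq_continuous (f := u)) cu => x xT.
by rewrite inE in xT; exact: uv.
Qed.

Lemma diff_on_ext {u v du dv} : {in `[0, T], u =1 v} ->
  {in `]0, T[, du =1 dv} -> diff_on u du -> diff_on v dv.
Proof.
move=> uv duv [cu du_]; split.
  exact: within_ext cu.
move=> t tT; have := du_ _ tT; rewrite (duv t tT).
apply: near_eq_is_derive; rewrite ?oner_neq0//.
have : \forall s \near t, s \in `]0, T[ by exact: near_in_itvoo.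
apply: filterS => s sT; apply: uv.
exact: subset_itv_oo_cc sT.
Qed.

Lemma diff_on_cst c : diff_on (fun=> c) (fun=> 0).
Proof.
split=> [|t _]; last exact: is_derive_cst.
by apply: continuous_subspaceT => x; exact: cvg_cst.
Qed.

Lemma diff_on_id : diff_on id (fun=> 1).
Proof.
split=> [|t _]; last exact: is_derive_id.
by apply: continuous_subspaceT => x; exact: cvg_id.
Qed.

Lemma diff_onD {u v du dv} : diff_on u du -> diff_on v dv ->
  diff_on (fun t => u t + v t) (fun t => du t + dv t).
Proof.
move=> [cu du_] [cv dv_]; split=> [x|t tT]; last first.
  exact: is_deriveD (du_ _ tT) (dv_ _ tT).
by apply: cvgD; [exact: cu|exact: cv].
Qed.

Lemma diff_onM {u v du dv} : diff_on u du -> diff_on v dv ->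
  diff_on (fun t => u t * v t) (fun t => du t * v t + u t * dv t).
Proof.
move=> [cu du_] [cv dv_]; split=> [x|t tT]; last first.
  rewrite addrC (mulrC (du t)).
  exact: is_deriveM (du_ _ tT) (dv_ _ tT).
by apply: cvgM; [exact: cu|exact: cv].
Qed.

Lemma diff_onZ c {u du} : diff_on u du ->
  diff_on (fun t => c * u t) (fun t => c * du t).
Proof.
move=> hu; apply: diff_on_ext (diff_onM (diff_on_cst c) hu) => // t _.
by rewrite mul0r add0r.
Qed.

Lemma diff_onB {u v du dv} : diff_on u du -> diff_on v dv ->
  diff_on (fun t => u t - v t) (fun t => du t - dv t).
Proof.
move=> hu hv.
by apply: diff_on_ext (diff_onD hu (diff_onZ (-1) hv)) => t _;
  rewrite mulN1r.
Qed.

Lemma diff_onX2 {u du} : diff_on u du ->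
  diff_on (fun t => u t ^+ 2) (fun t => 2 * (u t * du t)).
Proof.
move=> hu; apply: diff_on_ext (diff_onM hu hu) => // t _.
by rewrite /=; ring.
Qed.

Lemma diff_on_sum {n} {u du : nat -> R -> R} :
  (forall j, (j < n)%N -> diff_on (u j) (du j)) ->
  diff_on (fun t => \sum_(0 <= j < n) u j t) (fun t => \sum_(0 <= j < n) du j t).
Proof.
elim: n => [_|n IH h].
  by apply: diff_on_ext (diff_on_cst 0) => // t _; rewrite big_geq.
have hn := diff_onD (IH (fun j jn => h j (ltnW jn))) (h n (ltnSn n)).
by apply: diff_on_ext hn => t _; rewrite big_nat_recr.
Qed.

Lemma diff_on_expR c : diff_on (fun t => expR (c * t)) (fun t => c * expR (c * t)).
Proof.
split=> [|t _].
  apply: continuous_subspaceT => x; apply: continuous_comp.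
    by apply: cvgM; [exact: cvg_cst|exact: cvg_id].
  exact: continuous_expR.
have h : is_derive t 1 (fun s => c * s) c.
  have := is_deriveZ c (is_derive_id t (1 : R)).
  by rewrite /GRing.scale /= mulr1.
rewrite mulrC; have he := is_derive_expR (c * t).
exact: (is_derive1_comp (g := fun s : R => c * s) he h).
Qed.

Lemma diff_on_continuous {u du} : diff_on u du -> {within `[0, T], continuous u}.
Proof. by case. Qed.

Lemma diff_on_derive1 {u du t} : diff_on u du -> t \in `]0, T[ -> derive1 u t = du t.
Proof. by move=> [_ hu] tT; rewrite derive1E; have := hu _ tT; case. Qed.

(** This replaces the integration of differential inequalities: each estimate in time below exhibits
    a quantity with nonnegative derivative and compares its values at 0 and T. *)
Lemma diff_on_le {u du} : 0 < T -> diff_on u du ->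
  (forall t, t \in `]0, T[ -> 0 <= du t) -> u 0 <= u T.
Proof.
move=> T0 hu du0; have [cu du_] := hu.
apply: (ger0_derive1_le_cc (a := 0) (b := T)) => //; rewrite ?in_itv/= ?lexx ?ltW//.
- by move=> t tT; have [] := du_ _ tT.
- by move=> t tT; rewrite (diff_on_derive1 hu tT); exact: du0.
Qed.

End diff_on.
Arguments diff_on {R} T u du.

(** * Discrete identities and pointwise estimates *)

Section discrete_identities.
Context {R : realType} (N : nat).
Local Notation h := (hstep R N).
Local Notation D := (@dplush R N).

Lemma hstep_gt0 : 0 < h.
Proof. by rewrite /hstep invr_gt0 ltr0n. Qed.

Lemma hstep_neq0 : h != 0.
Proof. by rewrite gt_eqF// hstep_gt0. Qed.

Lemma hstepK : h * N.+1%:R = 1.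
Proof. by rewrite /hstep mulVf// pnatr_eq0. Qed.

(** Summation by parts in checkable form: once the flux [G] is named, a discrete integration by
    parts becomes a termwise algebraic identity. *)
Lemma sum_telescope (n : nat) (A B G : nat -> R) :
  (forall j, (j < n)%N -> A j = B j + (G j.+1 - G j)) ->
  \sum_(0 <= j < n) A j = \sum_(0 <= j < n) B j + (G n - G 0%N).
Proof.
move=> ABG; rewrite -(telescope_sumr G (leq0n n)) -big_split/=.
by apply: eq_big_nat => j /andP[_ jn]; exact: ABG.
Qed.

(* At [j = 0], [j.-1 = j] makes the first term vanish; as [w 0], [b 0] and [S 0]
   vanish too in the applications, sums can start at 0 uniformly. *)
Definition accel (w S : nat -> R) j : R := (D w j - D w j.-1) / h + S j.

Context (s : R) (w b S : nat -> R).
Hypotheses (b0 : b 0%N = 0) (bN : b N.+1 = 0).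
Local Notation om j := ((1 + s) ^+ j).

Lemma sum_shift : \sum_(0 <= j < N.+1) om j * (b j * D w j.-1) =
  (1 + s) * \sum_(0 <= j < N.+1) om j * (b j.+1 * D w j).
Proof.
rewrite (@sum_telescope _ _ (fun j => (1 + s) * (om j * (b j.+1 * D w j)))
  (fun j => - (om j * (b j * D w j.-1)))) => [|j _]; last by rewrite exprS/=; ring.
by rewrite b0 bN !(mul0r, mulr0) subrr addr0 mulr_sumr.
Qed.

(** Discrete form of [b w_xx + w_x b_x = (b w_x)_x]. The flux vanishes at both ends because [b]
    does, and the term in [s] comes from the increment [s * om j] of the weight. *)
Lemma sum_energy :
  \sum_(0 <= j < N.+1) om j * (h * (b j * accel w S j + D w j * D b j)) =
  \sum_(0 <= j < N.+1) om j * (h * (b j * S j) - s * (b j.+1 * D w j)).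
Proof.
rewrite (@sum_telescope _ _ (fun j => om j * (h * (b j * S j) - s * (b j.+1 * D w j)))
  (fun j => om j * (b j * D w j.-1))) => [|j _].
  by rewrite b0 bN !(mul0r, mulr0) subrr addr0.
have -> : D b j = (b j.+1 - b j) / h by [].
rewrite /accel exprS/=; field; exact: hstep_neq0.
Qed.

(** Discrete form of the multiplier identity [2 w_xx w_x + 2 b b_x = (w_x^2 + b^2)_x]. Here the flux
    survives at both ends: the right one is the observed quantity, and the left one will have a
    favourable sign. *)
Lemma sum_cross :
  \sum_(0 <= j < N.+1) om j * (h * (accel w S j * (D w j + D w j.-1) +
                                    b j * (D b j + D b j.-1))) =
  \sum_(0 <= j < N.+1) om j * (h * (S j * (D w j + D w j.-1)) -
                               s * (D w j ^+ 2 + b j * b j.+1)) +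
  (om N.+1 * D w N ^+ 2 - D w 0%N ^+ 2).
Proof.
rewrite (@sum_telescope _ _ (fun j => om j * (h * (S j * (D w j + D w j.-1)) -
                               s * (D w j ^+ 2 + b j * b j.+1)))
  (fun j => om j * (D w j.-1 ^+ 2 + b j * b j.-1))) => [|j _].
  by rewrite b0 bN !(mul0r, mulr0) !addr0 mul1r.
have Db i : D b i = (b i.+1 - b i) / h by [].
(* Index 0 is separate, since there [j.-1] is [j] and the identity relies on [b 0 = 0]. *)
case: j => [|j]; rewrite /accel !exprS/= !Db ?b0; field; exact: hstep_neq0.
Qed.

End discrete_identities.

(** The contribution of one grid point to the weighted rate, up to the weight and a factor [h]: [a],
    [a'] stand for [D w j], [D w j.-1], [B] for [b j], [d] for [b j.+1 - b j]. For [1/2 <= k < 1]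
    the form [(1 - k/2) (a^2 + B^2) + (2 k - 1) a B] has smallest eigenvalue [3/2 (1 - k)]; this
    coercivity absorbs all other terms through Young's inequality. *)
Lemma pointwise_form_ge {R : realFieldType} (k L s m F W SS B a a' d : R) :
  let c := 1 - k in
  1 / 2 <= k -> k < 1 -> 4 <= c * L -> 16 * m ^+ 2 <= L -> 0 <= s -> s <= c / 2 ->
  SS ^+ 2 <= 2 * F + 2 * m ^+ 2 * W ^+ 2 ->
  L * c / 8 * a ^+ 2 - L * c / 16 * a' ^+ 2
     - (2 * L / c * d ^+ 2 + 16 / (c * L) * F) <=
     SS * (B - a - a') + L * (a ^+ 2 + B * (B + d) - (B + d) * a
       - k / 2 * (B ^+ 2 + a ^+ 2) + k * (B * a) + k * W ^+ 2
       + k * (1 + s) * ((B + d) * a)) - 2 * (W * B).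
Proof.
move=> /=; set c := 1 - k => k12 k1 lk' lm s0 sh' SF.
have c0 : 0 < c by rewrite subr_gt0.
have L0 : 0 < L by rewrite -(pmulr_rgt0 _ c0); lra.
have cL : 0 < c * L by rewrite mulr_gt0.
have i1 : (1 - k / 2) * (a ^+ 2 + B ^+ 2) + (2 * k - 1) * (a * B) >=
          3 / 2 * c * (a ^+ 2 + B ^+ 2).
  have : 0 <= (k - 1 / 2) * (a + B) ^+ 2 by apply: mulr_ge0; [lra|exact: sqr_ge0].
  by rewrite /c; lra.
have i2 : k * s * (a * B) >= - (c / 4 * (a ^+ 2 + B ^+ 2)).
  have ks1 : 0 <= k * s by apply: mulr_ge0 => //; lra.
  have ? : 0 <= (1 - k) * s by apply: mulr_ge0 => //; lra.
  have ks2 : k * s <= c / 2 by lra.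
  have ? : 0 <= (c / 2 - k * s) * (a ^+ 2 + B ^+ 2).
    by apply: mulr_ge0; [lra|rewrite addr_ge0 ?sqr_ge0].
  have ? : 0 <= k * s * (a + B) ^+ 2 by rewrite mulr_ge0 ?sqr_ge0.
  lra.
have i3 (t x : R) : -1 <= t <= 1 -> d * (t * x) >= - (c / 4 * x ^+ 2) - d ^+ 2 / c.
  move=> /andP[t1 t2].
  have -> : d * (t * x) = c / 4 * (t * x + 2 * d / c) ^+ 2 - c / 4 * (t * x) ^+ 2 - d ^+ 2 / c.
    by field; rewrite gt_eqF.
  have ? : 0 <= c / 4 * (t * x + 2 * d / c) ^+ 2 by apply: mulr_ge0; [lra|exact: sqr_ge0].
  have ? : (t * x) ^+ 2 <= x ^+ 2.
    have ? : 0 <= (1 - t) * (1 + t) * x ^+ 2.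
      by apply: mulr_ge0; [apply: mulr_ge0; lra|exact: sqr_ge0].
    lra.
  have ? : c / 4 * (t * x) ^+ 2 <= c / 4 * x ^+ 2 by rewrite ler_wpM2l//; lra.
  lra.
have i4 (x e : R) : 0 < e -> SS * x >= - (e * x ^+ 2) - SS ^+ 2 / (4 * e).
  move=> e0; have -> : SS * x = e * (x + SS / (2 * e)) ^+ 2 - e * x ^+ 2 - SS ^+ 2 / (4 * e).
    by field; rewrite gt_eqF.
  have ? : 0 <= e * (x + SS / (2 * e)) ^+ 2 by rewrite mulr_ge0 ?sqr_ge0// ltW.
  lra.
(* Once [b j.+1] is written [B + d], this is the coefficient of [d * a]. *)
have tau : -1 <= k * (1 + s) - 1 <= 1.
  have ? : 0 <= k * (1 + s) by apply: mulr_ge0; lra.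
  have ? : 0 <= (1 - k) * (1 + s) by apply: mulr_ge0; lra.
  have ? : c <= 1 / 2 by rewrite /c; lra.
  by apply/andP; split; lra.
have j1 := i3 _ a tau.
have j2 : d * (1 * B) >= - (c / 4 * B ^+ 2) - d ^+ 2 / c by apply: i3; lra.
have e8 : 0 < c * L / 8 by lra.
(* The loss in [a'] is half of the gain kept in [a], because shifting the index in the sum will at
   most double it, up to a boundary term. *)
have e16 : 0 < c * L / 16 by lra.
have k1' := i4 B _ e8.
have k2' := i4 (- a) _ e8.
have k3' := i4 (- a') _ e16.
have SS' : SS ^+ 2 / (4 * (c * L / 8)) * 2 + SS ^+ 2 / (4 * (c * L / 16)) =
  8 / (c * L) * SS ^+ 2 by field; rewrite !gt_eqF.
have SSF : 8 / (c * L) * SS ^+ 2 <= 16 / (c * L) * F + 16 * m ^+ 2 / (c * L) * W ^+ 2.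
  have -> : 16 / (c * L) * F + 16 * m ^+ 2 / (c * L) * W ^+ 2 =
    8 / (c * L) * (2 * F + 2 * m ^+ 2 * W ^+ 2) by field; rewrite !gt_eqF.
  by rewrite ler_wpM2l// divr_ge0// ltW.
have mW : 16 * m ^+ 2 / (c * L) * W ^+ 2 <= L / 4 * W ^+ 2.
  rewrite ler_wpM2r ?sqr_ge0// ler_pdivrMr//.
  have ? : m ^+ 2 <= L / 16 by lra.
  have ? : L * 4 <= L * (c * L) by apply: ler_wpM2l => //; exact: ltW.
  lra.
have WB : - (2 * (W * B)) >= - W ^+ 2 - B ^+ 2 by have := sqr_ge0 (W - B); lra.
have B2 := sqr_ge0 B; have W2 := sqr_ge0 W.
have a2 : 0 <= c * L * a ^+ 2 by rewrite mulr_ge0 ?sqr_ge0// ltW.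
have cB : 4 * B ^+ 2 <= c * L * B ^+ 2 by rewrite ler_wpM2r.
have L8 : 8 <= L.
  have : c * L <= 1 / 2 * L by apply: ler_wpM2r; [exact: ltW|rewrite /c; lra].
  lra.
have LW : 8 * W ^+ 2 <= L * W ^+ 2 by rewrite ler_wpM2r ?sqr_ge0.
have kW : L * (1 / 2 * W ^+ 2) <= L * (k * W ^+ 2).
  by apply: ler_wpM2l; [exact: ltW|rewrite ler_wpM2r ?sqr_ge0].
have big : L * (- (c / 4 * a ^+ 2) - d ^+ 2 / c - (c / 4 * B ^+ 2) - d ^+ 2 / c
   + 3 / 2 * c * (a ^+ 2 + B ^+ 2) - (c / 4 * (a ^+ 2 + B ^+ 2))) <=
   L * (a ^+ 2 + B * (B + d) - (B + d) * a
     - k / 2 * (B ^+ 2 + a ^+ 2) + k * (B * a) + k * (1 + s) * ((B + d) * a)).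
  by apply: ler_wpM2l; [exact: ltW|lra].
have -> : 2 * L / c * d ^+ 2 = L * (d ^+ 2 / c) * 2 by field; rewrite gt_eqF.
set Y := L * (a ^+ 2 + B * (B + d) - _ - _ + _ + _) in big.
have -> : L * (a ^+ 2 + B * (B + d) - (B + d) * a
     - k / 2 * (B ^+ 2 + a ^+ 2) + k * (B * a) + k * W ^+ 2
     + k * (1 + s) * ((B + d) * a)) = Y + L * (k * W ^+ 2) by rewrite /Y; ring.
(* Products and quotients are generalized to atoms, so that what remains is linear. *)
move: Y (L * (k * W ^+ 2)) kW big SSF mW SS' => Y kW' kW big.
move: (8 / (c * L) * SS ^+ 2) (16 / (c * L) * F) (16 * m ^+ 2 / (c * L) * W ^+ 2).
move: (d ^+ 2 / c) big k1' k2' k3' => dc big.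
move: (SS ^+ 2 / (4 * (c * L / 8))) (SS ^+ 2 / (4 * (c * L / 16))).
clear -Y big kW WB B2 W2 a2 cB LW.
move=> *; lra.
Qed.



(** * Growth of the energy and rate of the weighted functional *)

Section pointwise_estimates.
Context {R : realType} (N : nat).
Local Notation h := (hstep R N).
Local Notation D := (@dplush R N).
Context (m : R) (w b f rho q : nat -> R).
Hypotheses (m0 : 0 <= m) (w0 : w 0%N = 0) (wN : w N.+1 = 0)
  (b0 : b 0%N = 0) (bN : b N.+1 = 0)
  (qm : forall j, (j <= N)%N -> `|q j| <= m).
Let S j : R := f j * rho j - q j * w j.

Lemma reaction_le j : (j <= N)%N -> (q j * w j) ^+ 2 <= m ^+ 2 * w j ^+ 2.
Proof.
move=> jN; rewrite exprMn ler_wpM2r ?sqr_ge0//.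
by rewrite -[leLHS]real_normK ?num_real// lerXn2r ?nnegrE// qm.
Qed.

(** The energy identity is used with [s = 0], that is with weight 1. Young's inequality then bounds
    the potential, the source and the product [w b], which gives the rate [m + 2]. *)
Lemma energy_rate_le :
  \sum_(0 <= j < N.+1) h * (b j * accel N w S j + D w j * D b j + w j * b j) <=
  (m + 2) * \sum_(0 <= j < N.+1) h / 2 * (b j ^+ 2 + D w j ^+ 2 + w j ^+ 2) +
  \sum_(0 <= j < N.+1) h / 2 * (f j ^+ 2 * rho j ^+ 2).
Proof.
have := sum_energy N 0 w b S b0 bN; rewrite addr0 => E.
have -> : \sum_(0 <= j < N.+1) h * (b j * accel N w S j + D w j * D b j + w j * b j)
    = \sum_(0 <= j < N.+1) h * (b j * S j + w j * b j).
  under eq_bigr do rewrite mulrDr; rewrite big_split/=.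
  under [X in X + _]eq_bigr => j _ do
    rewrite -[h * _]mul1r -[X in X * _](expr1n _ j).
  rewrite E -big_split/=; apply: eq_bigr => j _.
  by rewrite expr1n /=; ring.
rewrite mulr_sumr -big_split/=; apply: ler_sum_nat => j /andP[_ jN].
rewrite ltnS in jN.
have h0 := hstep_gt0 (R := R) N.
have -> : (m + 2) * (h / 2 * (b j ^+ 2 + D w j ^+ 2 + w j ^+ 2)) +
    h / 2 * (f j ^+ 2 * rho j ^+ 2) =
  h * (((m + 2) * (b j ^+ 2 + D w j ^+ 2 + w j ^+ 2) + f j ^+ 2 * rho j ^+ 2) / 2).
  by field.
rewrite ler_pM2l// /S.
have qw := qm j jN; rewrite ler_norml in qw; case/andP: qw => q1 q2.
have ? : 0 <= D w j ^+ 2 by exact: sqr_ge0.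
have ? : 0 <= (m + 2) * D w j ^+ 2 by rewrite mulr_ge0// addr_ge0.
have ? := sqr_ge0 (b j - f j * rho j).
have ? := sqr_ge0 (b j - w j); have ? := sqr_ge0 (w j).
have ? : 0 <= (m - q j) * (b j - w j) ^+ 2 by rewrite mulr_ge0 ?sqr_ge0// subr_ge0.
have ? : 0 <= (m + q j) * (b j + w j) ^+ 2 by rewrite mulr_ge0 ?sqr_ge0//; lra.
by lra.
Qed.

Context (lam kap : R).
Local Notation s := (lam * h).
Local Notation om j := ((1 + s) ^+ j).

(** Along a trajectory the left side is [e^{kap lam t}] times the derivative of [e^{- kap lam t} F].
    The pointwise bound is summed with the weights; its loss in [D w j.-1] is absorbed by the gain
    in [D w j], except for a remainder at [D w 0] that the left boundary term of [sum_cross]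
    covers. *)
Lemma weighted_rate_ge : 1 / 2 <= kap -> kap < 1 ->
  4 <= (1 - kap) * lam -> 16 * m ^+ 2 <= lam -> lam * h <= (1 - kap) / 2 ->
  \sum_(0 <= j < N.+1) om j * (h *
    (b j * accel N w S j + D w j * D b j
     - (accel N w S j * (D w j + D w j.-1) + b j * (D b j + D b j.-1))
     - 2 * (w j * b j)))
  - kap * lam * \sum_(0 <= j < N.+1) om j * (h *
      ((b j ^+ 2 + D w j ^+ 2) / 2 - b j * (D w j + D w j.-1) - w j ^+ 2))
  >= - (om N.+1 * D w N ^+ 2)
     - \sum_(0 <= j < N.+1) om j * (h *
         (2 * lam / (1 - kap) * (b j.+1 - b j) ^+ 2 +
          16 / ((1 - kap) * lam) * (f j ^+ 2 * rho j ^+ 2))).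
Proof.
move=> k12 k1 lk lm sh;
have h0 := hstep_gt0 (R := R) N.
have c0 : 0 < 1 - kap by rewrite subr_gt0.
have lam0 : 0 < lam by rewrite -(pmulr_rgt0 _ c0); lra.
have s0 : 0 < s by rewrite mulr_gt0.
have om0 j : 0 < om j by rewrite exprn_gt0// addr_gt0// mulr_gt0.
have E := sum_energy N s w b S b0 bN.
have Q := sum_cross N s w b S b0 bN.
have Sh := sum_shift N s w b b0 bN.
(* Shifting the index costs a factor [1 + s <= 2]; the extra [D w 0] is the summand at index 0,
   where [j.-1 = j]. *)
have P : \sum_(0 <= j < N.+1) om j * D w j.-1 ^+ 2 <=
    2 * (\sum_(0 <= j < N.+1) om j * D w j ^+ 2) + D w 0%N ^+ 2.
  rewrite (@sum_telescope _ _ _ (fun j => (1 + s) * (om j * D w j ^+ 2))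
    (fun j => - (om j * D w j.-1 ^+ 2))) => [|j _]; last first.
    by rewrite [om j.+1]exprS/=; ring.
  rewrite -mulr_sumr expr0 mul1r opprK.
  have X0 : 0 <= \sum_(0 <= j < N.+1) om j * D w j ^+ 2.
    by apply: sumr_ge0 => j _; rewrite mulr_ge0 ?sqr_ge0// ltW.
  have ? : 0 <= om N.+1 * D w N ^+ 2 by rewrite mulr_ge0 ?sqr_ge0// ltW.
  have ? : s * (\sum_(0 <= j < N.+1) om j * D w j ^+ 2) <=
    1 * \sum_(0 <= j < N.+1) om j * D w j ^+ 2 by rewrite ler_wpM2r//; lra.
  lra.
have term j : (j < N.+1)%N ->
   h * (b j * S j) - s * (b j.+1 * D w j)
   - (h * (S j * (D w j + D w j.-1)) - s * (D w j ^+ 2 + b j * b j.+1))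
   - h * (2 * (w j * b j))
   - kap * s * ((b j ^+ 2 + D w j ^+ 2) / 2 - b j * D w j - w j ^+ 2)
   + kap * s * (1 + s) * (b j.+1 * D w j) >=
   s * (1 - kap) / 8 * D w j ^+ 2 - s * (1 - kap) / 16 * D w j.-1 ^+ 2
   - h * (2 * lam / (1 - kap) * (b j.+1 - b j) ^+ 2 +
          16 / ((1 - kap) * lam) * (f j ^+ 2 * rho j ^+ 2)).
  move=> jN.
  set c := 1 - kap in c0 lk sh *.
  have -> : b j.+1 = b j + (b j.+1 - b j) by ring.
  rewrite [b j + _ - b j]addrAC subrr add0r.
  set d := b j.+1 - b j; set a := D w j; set a' := D w j.-1; set B := b j.
  set W := w j; set SS := S j; set F := f j ^+ 2 * rho j ^+ 2.
  have SF : SS ^+ 2 <= 2 * F + 2 * m ^+ 2 * W ^+ 2.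
    have := reaction_le j jN; rewrite -/W => ?.
    have ? := sqr_ge0 (f j * rho j + q j * W).
    rewrite /SS /S /F -/W.
    have -> : f j ^+ 2 * rho j ^+ 2 = (f j * rho j) ^+ 2 by rewrite exprMn.
    by nra.
  suff : lam * c / 8 * a ^+ 2 - lam * c / 16 * a' ^+ 2
     - (2 * lam / c * d ^+ 2 + 16 / (c * lam) * F) <=
     SS * (B - a - a') + lam * (a ^+ 2 + B * (B + d) - (B + d) * a
       - kap / 2 * (B ^+ 2 + a ^+ 2) + kap * (B * a) + kap * W ^+ 2
       + kap * (1 + s) * ((B + d) * a)) - 2 * (W * B).
    move=> /(ler_wpM2l (ltW h0)) => H.
    by apply: le_trans (le_trans H _); rewrite le_eqVlt; apply/orP; left;
      apply/eqP; field; rewrite ?gt_eqF.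
  exact: (pointwise_form_ge _ _ _ m _ _ _ _ _ _ _ k12 k1 lk lm (ltW s0) sh SF).
have -> : \sum_(0 <= j < N.+1) om j * (h *
    (b j * accel N w S j + D w j * D b j
     - (accel N w S j * (D w j + D w j.-1) + b j * (D b j + D b j.-1))
     - 2 * (w j * b j))) =
   \sum_(0 <= j < N.+1) om j * (h * (b j * accel N w S j + D w j * D b j)) -
   \sum_(0 <= j < N.+1) om j * (h * (accel N w S j * (D w j + D w j.-1) +
                                    b j * (D b j + D b j.-1))) -
   \sum_(0 <= j < N.+1) om j * (h * (2 * (w j * b j))).
  by rewrite -!sumrB; apply: eq_bigr => j _; ring.
(* The part of [F] with [b j * D w j.-1] is isolated so that [sum_shift] can turn it into
   [b j.+1 * D w j], the product occurring in the pointwise bound. *)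
have -> : \sum_(0 <= j < N.+1) om j * (h *
      ((b j ^+ 2 + D w j ^+ 2) / 2 - b j * (D w j + D w j.-1) - w j ^+ 2)) =
   \sum_(0 <= j < N.+1) om j * (h *
      ((b j ^+ 2 + D w j ^+ 2) / 2 - b j * D w j - w j ^+ 2)) -
   h * (\sum_(0 <= j < N.+1) om j * (b j * D w j.-1)).
  by rewrite mulr_sumr -sumrB; apply: eq_bigr => j _; ring.
rewrite E Q Sh.
have termS : \sum_(0 <= j < N.+1) om j * (s * (1 - kap) / 8 * D w j ^+ 2
     - s * (1 - kap) / 16 * D w j.-1 ^+ 2
     - h * (2 * lam / (1 - kap) * (b j.+1 - b j) ^+ 2 +
            16 / ((1 - kap) * lam) * (f j ^+ 2 * rho j ^+ 2))) <=
  \sum_(0 <= j < N.+1) om j * (h * (b j * S j) - s * (b j.+1 * D w j)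
   - (h * (S j * (D w j + D w j.-1)) - s * (D w j ^+ 2 + b j * b j.+1))
   - h * (2 * (w j * b j))
   - kap * s * ((b j ^+ 2 + D w j ^+ 2) / 2 - b j * D w j - w j ^+ 2)
   + kap * s * (1 + s) * (b j.+1 * D w j)).
  by apply: ler_sum_nat => j /andP[_ jN]; rewrite ler_pM2l//; exact: term.
have lhsE : \sum_(0 <= j < N.+1) om j * (s * (1 - kap) / 8 * D w j ^+ 2
     - s * (1 - kap) / 16 * D w j.-1 ^+ 2
     - h * (2 * lam / (1 - kap) * (b j.+1 - b j) ^+ 2 +
            16 / ((1 - kap) * lam) * (f j ^+ 2 * rho j ^+ 2))) =
   s * (1 - kap) / 8 * (\sum_(0 <= j < N.+1) om j * D w j ^+ 2) -
   s * (1 - kap) / 16 * (\sum_(0 <= j < N.+1) om j * D w j.-1 ^+ 2) -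
   \sum_(0 <= j < N.+1) om j * (h * (2 * lam / (1 - kap) * (b j.+1 - b j) ^+ 2 +
            16 / ((1 - kap) * lam) * (f j ^+ 2 * rho j ^+ 2))).
  by rewrite !mulr_sumr -!sumrB; apply: eq_bigr => j _; ring.
have rhsE : \sum_(0 <= j < N.+1) om j * (h * (b j * S j) - s * (b j.+1 * D w j)
   - (h * (S j * (D w j + D w j.-1)) - s * (D w j ^+ 2 + b j * b j.+1))
   - h * (2 * (w j * b j))
   - kap * s * ((b j ^+ 2 + D w j ^+ 2) / 2 - b j * D w j - w j ^+ 2)
   + kap * s * (1 + s) * (b j.+1 * D w j)) =
   \sum_(0 <= j < N.+1) om j * (h * (b j * S j) - s * (b j.+1 * D w j)) -
   \sum_(0 <= j < N.+1) om j * (h * (S j * (D w j + D w j.-1)) -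
                               s * (D w j ^+ 2 + b j * b j.+1)) -
   \sum_(0 <= j < N.+1) om j * (h * (2 * (w j * b j))) -
   kap * lam * (\sum_(0 <= j < N.+1) om j * (h *
      ((b j ^+ 2 + D w j ^+ 2) / 2 - b j * D w j - w j ^+ 2))) +
   kap * s * ((1 + s) * \sum_(0 <= j < N.+1) om j * (b j.+1 * D w j)).
  by rewrite !mulr_sumr -!sumrB -big_split/=; apply: eq_bigr => j _; ring.
rewrite lhsE rhsE in termS.
have P' : s * (1 - kap) / 16 * (\sum_(0 <= j < N.+1) om j * D w j.-1 ^+ 2) <=
  s * (1 - kap) / 16 * (2 * (\sum_(0 <= j < N.+1) om j * D w j ^+ 2) + D w 0%N ^+ 2).
  apply: ler_wpM2l => //; apply: divr_ge0 => //; apply: mulr_ge0; exact: ltW.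
have s16 : s * (1 - kap) / 16 * D w 0%N ^+ 2 <= 1 * D w 0%N ^+ 2.
  apply: ler_wpM2r; first exact: sqr_ge0.
  have ? : s * (1 - kap) <= s * 1 by apply: ler_wpM2l; [exact: ltW|lra].
  by have : s <= (1 - kap) / 2 by []; lra.
lra.
Qed.

End pointwise_estimates.

(* The weight [tau] stands for [T - t]. *)
Lemma coarse_form_ge {R : realFieldType} (n n0 m eps T tau w1 w w' b q x : R) :
  0 <= n <= n0 -> 0 < eps -> 0 <= tau <= T -> q ^+ 2 <= m ^+ 2 ->
  tau * (b * (n ^+ 2 * (w1 - 2 * w + w') + (x - q * w)) - 38 * (w * b)) -
    (b ^+ 2 / 2 - 19 * w ^+ 2) >=
  - ((1 / 2 + T ^+ 2 * (n0 ^+ 4 / 2 + 1 / (4 * eps) + m ^+ 2 / 2 + 38)) * b ^+ 2)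
  - eps * x ^+ 2 + 9 * w ^+ 2 - 3 / 2 * (w1 ^+ 2 + 4 * w ^+ 2 + w' ^+ 2).
Proof.
move=> /andP[n_0 nn0] eps0 /andP[t0 tT] qw.
have tT2 : tau ^+ 2 <= T ^+ 2 by rewrite lerXn2r// nnegrE// (le_trans t0).
have n4 : tau ^+ 2 * n ^+ 4 <= T ^+ 2 * n0 ^+ 4.
  rewrite ler_pM ?exprn_ge0// lerXn2r// nnegrE; exact: le_trans nn0.
have n4b : tau ^+ 2 * n ^+ 4 * b ^+ 2 <= T ^+ 2 * n0 ^+ 4 * b ^+ 2.
  by rewrite ler_wpM2r ?sqr_ge0.
have tb : tau ^+ 2 * b ^+ 2 <= T ^+ 2 * b ^+ 2 by rewrite ler_wpM2r ?sqr_ge0.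
have ie : 0 <= 1 / (4 * eps) by apply: divr_ge0 => //; lra.
have tbe : 1 / (4 * eps) * (tau ^+ 2 * b ^+ 2) <= 1 / (4 * eps) * (T ^+ 2 * b ^+ 2).
  by rewrite ler_wpM2l.
(* [k1] to [k4] are Young inequalities for the four products with [tau * b]: discrete Laplacian,
   source, potential and [38 w b]. *)
have k1 := sqr_ge0 (tau * n ^+ 2 * b + (w1 - 2 * w + w')).
have k2 : 0 <= eps * (x + tau * b / (2 * eps)) ^+ 2 by rewrite mulr_ge0 ?sqr_ge0// ltW.
have k2E : eps * (x + tau * b / (2 * eps)) ^+ 2 =
    eps * x ^+ 2 + tau * b * x + 1 / (4 * eps) * (tau ^+ 2 * b ^+ 2).
  by field; rewrite gt_eqF.
rewrite k2E in k2.
have k3 := sqr_ge0 (w - tau * b * q).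
have k3' : tau ^+ 2 * b ^+ 2 * q ^+ 2 <= T ^+ 2 * b ^+ 2 * m ^+ 2.
  by apply: ler_pM => //; [apply: mulr_ge0|]; exact: sqr_ge0.
(* Of the available [19 w^2], the product [38 w b] takes [19/2] and the potential [1/2]. The
   remaining 9 equals [3/2 (1 + 4 + 1)], the cost of the squared Laplacian after summation over the
   grid; this fixes the constant 19. *)
have k4 := sqr_ge0 (w - 2 * tau * b).
have k5 : (w1 - 2 * w + w') ^+ 2 <= 3 * (w1 ^+ 2 + 4 * w ^+ 2 + w' ^+ 2).
  have := sqr_ge0 (w1 + 2 * w); have := sqr_ge0 (w1 - w'); have := sqr_ge0 (2 * w + w').
  lra.
move: k1 k2 k3 k4 n4b tb tbe; rewrite !(sqrrD, sqrrB, exprMn) => k1 k2 k3 k4 n4b tb tbe.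
lra.
Qed.

(** * Coarse grids: control by the viscosity term alone *)

Section coarse.
Context {R : realType} (N : nat).
Local Notation h := (hstep R N).

(** Cauchy-Schwarz for the telescoping sum of the increments of [b], proved by induction. *)
Lemma sqr_le_sum_diff (b : nat -> R) j : b 0%N = 0 ->
  b j ^+ 2 <= j%:R * \sum_(0 <= k < j) (b k.+1 - b k) ^+ 2.
Proof.
move=> b0; elim: j => [|j IH]; first by rewrite b0 expr0n mul0r.
case: j IH => [_|j IH]; first by rewrite big_nat1 b0 subr0 mul1r.
rewrite big_nat_recr//=.
set s := \sum_(_ <= _ < _) _ in IH *; set d := b j.+2 - b j.+1.
have -> : b j.+2 = b j.+1 + d by rewrite /d; ring.
have j0 : 0 < j.+1%:R :> R by rewrite ltr0n.
rewrite -(ler_pM2l j0) -[j.+2%:R]natr1.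
move: (j.+1%:R) j0 IH => x x0 IH.
have ? := sqr_ge0 (b j.+1 - x * d).
have ? : (x + 1) * b j.+1 ^+ 2 <= (x + 1) * (x * s) by rewrite ler_wpM2l//; lra.
lra.
Qed.

(** With [tau = T - t] this bounds from below the derivative of
    [(T - t) sum_j (b_j^2 / 2 - 19 w_j^2)]. A discrete Poincare inequality bounds the sum of the
    [b_j^2] by [n0^2] times the viscosity term. The terms in [w] sum to something nonnegative, as
    the shifted sums of squares do not exceed the unshifted one. *)
Lemma coarse_rate_ge (n0 m eps T tau : R) (w b f rho q : nat -> R) :
  w 0%N = 0 -> w N.+1 = 0 -> b 0%N = 0 ->
  N.+1%:R <= n0 -> 0 <= m -> 0 < eps -> 0 <= tau <= T ->
  (forall j, (j <= N)%N -> `|q j| <= m) ->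
  tau * (\sum_(0 <= j < N.+1) (b j * accel N w (fun j => f j * rho j - q j * w j) j
                               - 38 * (w j * b j))) -
    \sum_(0 <= j < N.+1) (b j ^+ 2 / 2 - 19 * w j ^+ 2) >=
  - ((1 / 2 + T ^+ 2 * (n0 ^+ 4 / 2 + 1 / (4 * eps) + m ^+ 2 / 2 + 38)) * n0 ^+ 2 *
     \sum_(0 <= j < N.+1) (b j.+1 - b j) ^+ 2)
  - eps * \sum_(0 <= j < N.+1) f j ^+ 2 * rho j ^+ 2.
Proof.
move=> w0 wN b0 nn0 m0 eps0 tT qm.
set C := 1 / 2 + _; set V := \sum_(0 <= j < N.+1) (b j.+1 - b j) ^+ 2.
have n00 : 0 <= n0 by apply: le_trans nn0.
have C0 : 0 <= C.
  have ? : 0 <= n0 ^+ 4 by exact: exprn_ge0.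
  have ? : 0 <= m ^+ 2 by exact: sqr_ge0.
  have ? : 0 <= 1 / (4 * eps) by apply: divr_ge0 => //; lra.
  by rewrite /C addr_ge0//; apply: mulr_ge0; [exact: sqr_ge0|lra].
have bV : C * \sum_(0 <= j < N.+1) b j ^+ 2 <= C * (n0 ^+ 2 * V).
  apply: ler_wpM2l => //.
  have V0 : 0 <= V by apply: sumr_ge0 => k _; exact: sqr_ge0.
  apply: (@le_trans _ _ (\sum_(0 <= j < N.+1) (n0 * V))).
    apply: ler_sum_nat => j /andP[_ jN]; apply: le_trans (sqr_le_sum_diff b j b0) _.
    apply: ler_pM => //.
    - by apply: sumr_ge0 => k _; exact: sqr_ge0.
    - by apply: le_trans nn0; rewrite ler_nat ltnW.
    - rewrite /V [leRHS](big_cat_nat (n := j)) ?(ltnW jN)//= lerDl.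
      by apply: sumr_ge0 => k _; exact: sqr_ge0.
  rewrite big_const_nat subn0 iter_addr addr0 -mulr_natl mulrA expr2 -mulrA mulrA.
  by rewrite !ler_wpM2r//; apply: le_trans nn0.
have w1S : \sum_(0 <= j < N.+1) w j.+1 ^+ 2 = \sum_(0 <= j < N.+1) w j ^+ 2.
  by rewrite (sum_telescope _ _ (fun j => w j ^+ 2) (fun j => w j ^+ 2)) => [|j _];
    [rewrite w0 wN subrr addr0|ring].
have w'S : \sum_(0 <= j < N.+1) w j.-1 ^+ 2 <= \sum_(0 <= j < N.+1) w j ^+ 2.
  rewrite big_nat_recl//= w0 expr0n add0r [leRHS]big_nat_recr//= lerDl; exact: sqr_ge0.
have H : \sum_(0 <= j < N.+1) (- (C * b j ^+ 2) - eps * (f j ^+ 2 * rho j ^+ 2) + 9 * w j ^+ 2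
    - 3 / 2 * (w j.+1 ^+ 2 + 4 * w j ^+ 2 + w j.-1 ^+ 2)) <=
   \sum_(0 <= j < N.+1) (tau * (b j * accel N w (fun j => f j * rho j - q j * w j) j
       - 38 * (w j * b j)) - (b j ^+ 2 / 2 - 19 * w j ^+ 2)).
  apply: ler_sum_nat => j /andP[_ jN].
  have q2 : q j ^+ 2 <= m ^+ 2.
    by rewrite -[leLHS]real_normK ?num_real// lerXn2r// ?nnegrE// qm.
  have nn : (0 <= N.+1%:R :> R) && (N.+1%:R <= n0) by rewrite ler0n nn0.
  have := coarse_form_ge N.+1%:R n0 m eps T tau (w j.+1) (w j) (w j.-1) (b j) (q j)
    (f j * rho j) nn eps0 tT q2.
  rewrite exprMn => /le_trans; apply; rewrite le_eqVlt; apply/orP; left; apply/eqP.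
  congr (_ * (_ - _) - _).
  (* At index 0 [accel] is not the discrete Laplacian, but the factor [b 0] vanishes. *)
  case: j {jN q2} => [|j]; first by rewrite b0 !mul0r.
  congr (_ * _); rewrite /accel /dplush/= /hstep; field.
  by rewrite addrC natr1 pnatr_eq0.
have lhsE : \sum_(0 <= j < N.+1) (- (C * b j ^+ 2) - eps * (f j ^+ 2 * rho j ^+ 2) + 9 * w j ^+ 2
    - 3 / 2 * (w j.+1 ^+ 2 + 4 * w j ^+ 2 + w j.-1 ^+ 2)) =
  9 * \sum_(0 <= j < N.+1) w j ^+ 2 - C * \sum_(0 <= j < N.+1) b j ^+ 2 -
  eps * \sum_(0 <= j < N.+1) f j ^+ 2 * rho j ^+ 2 -
  3 / 2 * \sum_(0 <= j < N.+1) w j.+1 ^+ 2 - 6 * \sum_(0 <= j < N.+1) w j ^+ 2 -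
  3 / 2 * \sum_(0 <= j < N.+1) w j.-1 ^+ 2.
  by rewrite !mulr_sumr -!sumrB; apply: eq_bigr => j _; field.
rewrite lhsE w1S sumrB -mulr_sumr in H.
lra.
Qed.

End coarse.

(** * Stability for abstract trajectories *)

(** The first summand serves fine grids, the second coarse ones: [n0] bounds [N + 1] as soon as
    [lam h >= (1 - kap) / 2], and [eps] is chosen so that [eps K^2 = T r^2 / 4]. Nothing depends on
    [N]. *)
Definition stability_constant {R : realType} (T m K r kap lam : R) : R :=
  let n0 := 2 * lam / (1 - kap) in let eps := T * r ^+ 2 / (4 * K ^+ 2) in
  4 / r ^+ 2 * (expR lam * (1 + n0)) +
  4 / (T * r ^+ 2) *
    ((1 / 2 + T ^+ 2 * (n0 ^+ 4 / 2 + 1 / (4 * eps) + m ^+ 2 / 2 + 38)) * n0 ^+ 2).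

Section stability.
Context {R : realType} (N : nat) (T m K r B : R).
Local Notation h := (hstep R N).
Local Notation D := (@dplush R N).
Context (w b rho : nat -> R -> R) (f q : nat -> R) (A V : R -> R) (P : nat -> R -> R).
(** Lower-order part of the equation for [w = z']: in the application [f = p - q] and [rho] is the
    time derivative of [y[p]], while [B] bounds the squared initial values of [y[p]]. *)
Let S t j : R := f j * rho j t - q j * w j t.
Hypotheses (T1 : 1 < T) (m0 : 0 <= m) (K0 : 0 < K) (r0 : 0 < r).
Hypotheses (w0 : forall t, w 0%N t = 0) (wN : forall t, w N.+1 t = 0)
  (b0 : forall t, b 0%N t = 0) (bN : forall t, b N.+1 t = 0)
  (qm : forall j, (j <= N)%N -> `|q j| <= m).
Hypotheses
  (dw : forall j, (j <= N.+1)%N -> diff_on T (w j) (b j))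
  (db : forall j, (j <= N)%N ->
     diff_on T (b j) (fun t => accel N (w ^~ t) (S t) j))
  (wi : forall j, (j <= N.+1)%N -> w j 0 = 0)
  (bge : forall j, (j <= N)%N -> r ^+ 2 * f j ^+ 2 <= b j 0 ^+ 2)
  (ble : forall j, (j <= N)%N -> b j 0 ^+ 2 <= B * f j ^+ 2).
(* [A], [V] and [P j] are primitives, so that no integral enters the estimates. *)
Hypotheses
  (dA : diff_on T A (fun t => D (w ^~ t) N ^+ 2)) (A0 : A 0 = 0)
  (dV : diff_on T V (fun t => \sum_(0 <= j < N.+1) (b j.+1 t - b j t) ^+ 2))
  (V0 : V 0 = 0)
  (dP : forall j, (j <= N)%N -> diff_on T (P j) (fun t => rho j t ^+ 2))
  (P0 : forall j, P j 0 = 0) (PT : forall j, (j <= N)%N -> P j T <= K ^+ 2).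

Let h0 : 0 < h := hstep_gt0 N.
Let T0 : 0 < T := lt_trans ltr01 T1.

Let dDw j : (j <= N)%N -> diff_on T (fun t => D (w ^~ t) j) (fun t => D (b ^~ t) j).
Proof.
move=> jN.
have := diff_onM (diff_onB (dw j.+1 jN) (dw j (leqW jN))) (diff_on_cst h^-1).
by apply: diff_on_ext => // t _; rewrite mulr0 addr0.
Qed.

Let DwT0 j : (j <= N)%N -> D (w ^~ 0) j = 0.
Proof. by move=> jN; rewrite /dplush !wi ?ltnS// ?subrr ?mul0r// leqW. Qed.

Let pred_le j : (j <= N)%N -> (j.-1 <= N)%N.
Proof. exact/leq_trans/leq_pred. Qed.

Let E t : R := \sum_(0 <= j < N.+1) h / 2 * (b j t ^+ 2 + D (w ^~ t) j ^+ 2 + w j t ^+ 2).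

(** Gronwall's argument: [G - e^{-(m + 2) t} E] is nondecreasing, where [G] is the time primitive of
    the source terms. Initially [w = 0], so only [b] contributes to [E 0]. *)
Lemma energy_le : E T <= expR ((m + 2) * T) * ((B + K ^+ 2) / 2) *
  (h * \sum_(0 <= j < N.+1) f j ^+ 2).
Proof.
pose G t := \sum_(0 <= j < N.+1) h / 2 * (f j ^+ 2 * P j t).
have dE : diff_on T E (fun t => \sum_(0 <= j < N.+1) h *
    (b j t * accel N (w ^~ t) (S t) j + D (w ^~ t) j * D (b ^~ t) j + w j t * b j t)).
  apply: diff_on_sum => j jN.
  apply: diff_on_ext (diff_onZ (h / 2) (diff_onD (diff_onD (diff_onX2 (db j jN))
    (diff_onX2 (dDw j jN))) (diff_onX2 (dw j (leqW jN))))) => // t _ /=.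
  by field.
have dG : diff_on T G (fun t => \sum_(0 <= j < N.+1) h / 2 * (f j ^+ 2 * rho j t ^+ 2)).
  by apply: diff_on_sum => j jN; do 2 apply: diff_onZ; exact: dP.
have := diff_on_le T0 (diff_onB dG (diff_onM (diff_on_expR (- (m + 2))) dE)).
set c := m + 2.
have pos (t : R) : t \in `]0, T[ -> 0 <= \sum_(0 <= j < N.+1) h / 2 * (f j ^+ 2 * rho j t ^+ 2) -
   (- c * expR (- c * t) * E t + expR (- c * t) * \sum_(0 <= j < N.+1) h *
    (b j t * accel N (w ^~ t) (S t) j + D (w ^~ t) j * D (b ^~ t) j + w j t * b j t)).
  rewrite in_itv/= => /andP[t0 _].
  have := energy_rate_le N m (w ^~ t) (b ^~ t) f (rho ^~ t) q m0 (b0 t) (bN t) qm.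
  set X := \sum_(_ <= _ < _) _; set Y := \sum_(_ <= _ < _) _; rewrite -/(E t).
  set Z := \sum_(_ <= _ < _) _ => XYZ.
  have e0 := expR_gt0 (- c * t).
  have e1 : expR (- c * t) <= 1.
    by rewrite -expR0 ler_expR mulNr oppr_le0 mulr_ge0 ?(ltW t0)// /c addr_ge0.
  have Z0 : 0 <= Z.
    by apply: sumr_ge0 => j _; rewrite mulr_ge0 ?divr_ge0 ?(ltW h0)// mulr_ge0 ?sqr_ge0.
  have ? : expR (- c * t) * X <= expR (- c * t) * ((m + 2) * E t + Z).
    by apply: ler_wpM2l; first exact: ltW.
  have ? : expR (- c * t) * Z <= 1 * Z by exact: ler_wpM2r.
  by rewrite /c in e0 e1 *; lra.
move=> /(_ pos); rewrite mulr0 expR0 mul1r.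
have -> : G 0 = 0 by rewrite /G big1// => j _; rewrite P0 !mulr0.
set F := h * \sum_(0 <= j < N.+1) f j ^+ 2.
have F0 : 0 <= F.
  by apply: mulr_ge0; [exact: ltW|apply: sumr_ge0 => j _; exact: sqr_ge0].
have GT : G T <= K ^+ 2 / 2 * F.
  rewrite /G /F mulrA mulr_sumr; apply: ler_sum_nat => j /andP[_ jN].
  have -> : K ^+ 2 / 2 * h * f j ^+ 2 = h / 2 * (f j ^+ 2 * K ^+ 2) by field.
  by rewrite ler_wpM2l ?divr_ge0 ?(ltW h0)// ler_wpM2l ?sqr_ge0// PT.
have E0 : E 0 <= B / 2 * F.
  rewrite /E /F mulrA mulr_sumr; apply: ler_sum_nat => j /andP[_ jN].
  rewrite DwT0// wi ?(ltnW jN)// expr0n !addr0.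
  have -> : B / 2 * h * f j ^+ 2 = h / 2 * (B * f j ^+ 2) by field.
  by rewrite ler_wpM2l ?divr_ge0 ?(ltW h0)// ble.
move=> H; have : expR (- c * T) * E T <= (B + K ^+ 2) / 2 * F by lra.
have ee : expR (c * T) * expR (- c * T) = 1 by rewrite -expRD mulNr subrr expR0.
move=> /(ler_wpM2l (expR_ge0 (c * T))) H'.
by rewrite [leLHS]mulrA ee mul1r [leRHS]mulrA in H'.
Qed.

(** Follows from [1 + x <= e^x] and [j h <= 1]; the weights are thus bounded uniformly in [N]. *)
Lemma expr_le_expR (lam : R) j : 0 <= lam -> (j <= N.+1)%N ->
  (1 + lam * h) ^+ j <= expR lam.
Proof.
move=> lam0 jN; have lh : 0 <= lam * h by rewrite mulr_ge0// ltW.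
apply: (@le_trans _ _ (expR (lam * h) ^+ j)).
  by rewrite lerXn2r ?nnegrE ?expR_ge0 ?addr_ge0// expR_ge1Dx.
rewrite -expRM_natl ler_expR mulrCA ler_piMr//.
rewrite -[leRHS](hstepK (R := R) N) [leLHS]mulrC; apply: ler_wpM2l; first exact: ltW.
by rewrite ler_nat.
Qed.

Let F lam t : R := \sum_(0 <= j < N.+1) (1 + lam * h) ^+ j * (h *
  ((b j t ^+ 2 + D (w ^~ t) j ^+ 2) / 2
   - b j t * (D (w ^~ t) j + D (w ^~ t) j.-1) - w j t ^+ 2)).

Lemma F_le_energy lam t : 0 <= lam -> F lam t <= 4 * expR lam * E t.
Proof.
move=> lam0.
have lh : 0 <= lam * h by rewrite mulr_ge0// ltW.
have a'a : \sum_(0 <= j < N.+1) D (w ^~ t) j.-1 ^+ 2 <=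
    2 * \sum_(0 <= j < N.+1) D (w ^~ t) j ^+ 2.
  have a0 : D (w ^~ t) 0%N ^+ 2 <= \sum_(0 <= j < N.+1) D (w ^~ t) j ^+ 2.
    by rewrite big_nat_recl//= lerDl; apply: sumr_ge0 => j _; exact: sqr_ge0.
  rewrite big_nat_recl//= mulr2n mulrDl mul1r lerD//.
  by rewrite [leRHS]big_nat_recr//= lerDl sqr_ge0.
apply: (@le_trans _ _ (expR lam * (\sum_(0 <= j < N.+1) h * (3 / 2 * b j t ^+ 2 +
    D (w ^~ t) j ^+ 2 + D (w ^~ t) j.-1 ^+ 2 / 2)))).
  rewrite mulr_sumr; apply: ler_sum_nat => j /andP[_ jN].
  set a := D _ _; set a' := D _ _.
  have pos : 0 <= 3 / 2 * b j t ^+ 2 + a ^+ 2 + a' ^+ 2 / 2.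
    have := sqr_ge0 (b j t); have := sqr_ge0 a; have := sqr_ge0 a'; lra.
  apply: (@le_trans _ _ ((1 + lam * h) ^+ j * (h * (3 / 2 * b j t ^+ 2 + a ^+ 2 + a' ^+ 2 / 2)))).
    rewrite ler_wpM2l ?exprn_ge0 ?addr_ge0// ler_wpM2l ?(ltW h0)//.
    have := sqr_ge0 (w j t); have := sqr_ge0 (b j t + a); have := sqr_ge0 (b j t + a'); lra.
  by rewrite ler_wpM2r ?mulr_ge0 ?(ltW h0)// expr_le_expR// ltnW.
have -> : 4 * expR lam * E t = expR lam * (4 * E t) by ring.
rewrite ler_wpM2l ?expR_ge0// /E.
set Y := \sum_(0 <= j < N.+1) D (w ^~ t) j ^+ 2 in a'a.
set Y' := \sum_(0 <= j < N.+1) D (w ^~ t) j.-1 ^+ 2 in a'a.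
pose X := \sum_(0 <= j < N.+1) b j t ^+ 2.
pose Z := \sum_(0 <= j < N.+1) w j t ^+ 2.
have -> : \sum_(0 <= j < N.+1) h * (3 / 2 * b j t ^+ 2 +
    D (w ^~ t) j ^+ 2 + D (w ^~ t) j.-1 ^+ 2 / 2) = h * (3 / 2 * X + Y + 1 / 2 * Y').
  by rewrite /X /Y /Y' !mulr_sumr -!big_split/= mulr_sumr; apply: eq_bigr => j _; field.
have -> : \sum_(0 <= j < N.+1) h / 2 * (b j t ^+ 2 + D (w ^~ t) j ^+ 2 + w j t ^+ 2) =
    h * ((X + Y + Z) / 2).
  by rewrite /X /Y /Z -!big_split/= mulr_suml mulr_sumr; apply: eq_bigr => j _; field.
have ? : 0 <= X by apply: sumr_ge0 => j _; exact: sqr_ge0.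
have ? : 0 <= Z by apply: sumr_ge0 => j _; exact: sqr_ge0.
have -> : 4 * (h * ((X + Y + Z) / 2)) = h * (2 * (X + Y + Z)) by field.
by rewrite ler_pM2l//; lra.
Qed.

(* The last two hypotheses absorb, for [lam] large, the contributions of the
   source term and of the final time. *)
Lemma fine_stability (kap lam : R) :
  1 / 2 <= kap -> kap < 1 -> 4 <= (1 - kap) * lam -> 16 * m ^+ 2 <= lam ->
  lam * h <= (1 - kap) / 2 ->
  16 / ((1 - kap) * lam) * K ^+ 2 <= r ^+ 2 / 8 ->
  4 * expR (lam - kap * lam * T) * (expR ((m + 2) * T) * ((B + K ^+ 2) / 2)) <=
    r ^+ 2 / 8 ->
  r ^+ 2 / 4 * (h * \sum_(0 <= j < N.+1) f j ^+ 2) <=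
  expR lam * A T + 2 * lam / (1 - kap) * expR lam * (h * V T).
Proof.
move=> k12 k1 lk lm sh cK cE.
have c0 : 0 < 1 - kap by rewrite subr_gt0.
have lam0 : 0 < lam by rewrite -(pmulr_rgt0 _ c0); apply: lt_le_trans lk.
have cl0 : 0 < (1 - kap) * lam by rewrite mulr_gt0.
have lh : 0 <= lam * h by rewrite mulr_ge0// ltW.
have om0 j : 0 <= (1 + lam * h) ^+ j by rewrite exprn_ge0 ?addr_ge0.
have om1 j : 1 <= (1 + lam * h) ^+ j by rewrite exprn_ege1// lerDl.
set mu := kap * lam; set C1 := 2 * lam / (1 - kap); set C2 := 16 / ((1 - kap) * lam).
have C10 : 0 <= C1 by rewrite divr_ge0 ?mulr_ge0// ltW.
have C20 : 0 <= C2 by rewrite divr_ge0// ltW.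
have mu0 : 0 <= mu by apply: mulr_ge0; [apply: le_trans k12|exact: ltW].
pose G t := \sum_(0 <= j < N.+1) (1 + lam * h) ^+ j * (h * (f j ^+ 2 * P j t)).
have dG : diff_on T G (fun t => \sum_(0 <= j < N.+1)
    (1 + lam * h) ^+ j * (h * (f j ^+ 2 * rho j t ^+ 2))).
  by apply: diff_on_sum => j jN; do 3 apply: diff_onZ; exact: dP.
have dF : diff_on T (F lam) (fun t => \sum_(0 <= j < N.+1) (1 + lam * h) ^+ j * (h *
    (b j t * accel N (w ^~ t) (S t) j + D (w ^~ t) j * D (b ^~ t) j
     - (accel N (w ^~ t) (S t) j * (D (w ^~ t) j + D (w ^~ t) j.-1)
        + b j t * (D (b ^~ t) j + D (b ^~ t) j.-1))
     - 2 * (w j t * b j t)))).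
  apply: diff_on_sum => j jN; do 2 apply: diff_onZ.
  have jp := pred_le j jN.
  apply: diff_on_ext (diff_onB (diff_onB
    (diff_onM (diff_onD (diff_onX2 (db j jN)) (diff_onX2 (dDw j jN))) (diff_on_cst 2^-1))
    (diff_onM (db j jN) (diff_onD (dDw j jN) (dDw _ jp))))
    (diff_onX2 (dw j (leqW jN)))) => // t _ /=.
  by field.
(* The nondecreasing quantity is [e^{- mu t} F + e^lam A + C1 e^lam h V + C2 G], with
   [mu = kap lam]. *)
have := diff_on_le T0 (diff_onD (diff_onD (diff_onD
  (diff_onM (diff_on_expR (- mu)) dF) (diff_onZ (expR lam) dA))
  (diff_onZ (C1 * expR lam * h) dV)) (diff_onZ C2 dG)).
have pos (t : R) : t \in `]0, T[ -> 0 <= - mu * expR (- mu * t) * F lam t +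
    expR (- mu * t) * (\sum_(0 <= j < N.+1) (1 + lam * h) ^+ j * (h *
    (b j t * accel N (w ^~ t) (S t) j + D (w ^~ t) j * D (b ^~ t) j
     - (accel N (w ^~ t) (S t) j * (D (w ^~ t) j + D (w ^~ t) j.-1)
        + b j t * (D (b ^~ t) j + D (b ^~ t) j.-1))
     - 2 * (w j t * b j t)))) + expR lam * D (w ^~ t) N ^+ 2 +
    C1 * expR lam * h * (\sum_(0 <= j < N.+1) (b j.+1 t - b j t) ^+ 2) +
    C2 * (\sum_(0 <= j < N.+1) (1 + lam * h) ^+ j * (h * (f j ^+ 2 * rho j t ^+ 2))).
  rewrite in_itv/= => /andP[t0 _].
  have := weighted_rate_ge N m (w ^~ t) (b ^~ t) f (rho ^~ t) q m0 (b0 t) (bN t) qm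
    lam kap k12 k1 lk lm sh.
  rewrite -/(F lam t) -/mu -/C1 -/C2 -/(S t).
  set W := \sum_(0 <= j < N.+1) _; set X := \sum_(0 <= j < N.+1) _ => H.
  set a2 := D (w ^~ t) N ^+ 2 in H *.
  have a20 : 0 <= a2 by exact: sqr_ge0.
  set Y := \sum_(0 <= j < N.+1) (b j.+1 t - b j t) ^+ 2.
  set Z := \sum_(0 <= j < N.+1) _ * (_ * (_ ^+ 2 * _)).
  (* The weights are bounded by [e^lam] in the viscosity term only. The source keeps them, because
     it has to be absorbed by the weighted norm [X] with a constant [C2] that is small for large
     [lam]. *)
  have WYZ : W <= C1 * expR lam * h * Y + C2 * Z.
    rewrite /W /Y /Z !mulr_sumr -big_split/=; apply: ler_sum_nat => j /andP[_ jN].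
    rewrite mulrDr mulrDr; apply: lerD; last by rewrite le_eqVlt; apply/orP; left; apply/eqP; ring.
    have -> : C1 * expR lam * h * (b j.+1 t - b j t) ^+ 2 =
      expR lam * (h * (C1 * (b j.+1 t - b j t) ^+ 2)) by ring.
    by rewrite ler_wpM2r ?expr_le_expR ?(ltW lam0) ?(ltnW jN)//
      mulr_ge0 ?(ltW h0)// mulr_ge0// sqr_ge0.
  have oa : (1 + lam * h) ^+ N.+1 * a2 <= expR lam * a2.
    by rewrite ler_wpM2r ?expr_le_expR// ltW.
  have W0 : 0 <= W.
    apply: sumr_ge0 => j _; rewrite mulr_ge0// mulr_ge0 ?(ltW h0)// addr_ge0//.
      by rewrite mulr_ge0 ?sqr_ge0.
    by rewrite mulr_ge0// mulr_ge0 ?sqr_ge0.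
  have oa0 : 0 <= (1 + lam * h) ^+ N.+1 * a2 by rewrite mulr_ge0.
  have e0 := expR_ge0 (- mu * t).
  have e1 : expR (- mu * t) <= 1.
    by rewrite -expR0 ler_expR mulNr oppr_le0 mulr_ge0 ?(ltW t0).
  have H1 := ler_wpM2l e0 H.
  have : expR (- mu * t) * ((1 + lam * h) ^+ N.+1 * a2 + W) <=
    1 * ((1 + lam * h) ^+ N.+1 * a2 + W) by rewrite ler_wpM2r// addr_ge0.
  lra.
move=> /(_ pos); rewrite mulr0 expR0 mul1r A0 V0 !mulr0 !addr0.
have -> : G 0 = 0 by rewrite /G big1// => j _; rewrite P0 !mulr0.
rewrite mulr0 addr0.
set X0 := h * \sum_(0 <= j < N.+1) f j ^+ 2.
pose X := \sum_(0 <= j < N.+1) (1 + lam * h) ^+ j * (h * f j ^+ 2).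
have X0X : X0 <= X.
  rewrite /X0 mulr_sumr; apply: ler_sum_nat => j _.
  by apply: ler_peMl => //; rewrite mulr_ge0 ?sqr_ge0 ?(ltW h0).
have X00 : 0 <= X0.
  by apply: mulr_ge0; [exact: ltW|apply: sumr_ge0 => j _; exact: sqr_ge0].
(* At time 0 only [b^2 / 2] survives in [F]. Of this [r^2 / 2], the source and the final time each
   consume [r^2 / 8], which leaves [r^2 / 4]. *)
have F0 : r ^+ 2 / 2 * X <= F lam 0.
  rewrite /F /X mulr_sumr; apply: ler_sum_nat => j /andP[_ jN].
  rewrite !DwT0 ?pred_le// wi ?(ltnW jN)// expr0n !addr0 mulr0 !subr0.
  have -> : r ^+ 2 / 2 * ((1 + lam * h) ^+ j * (h * f j ^+ 2)) =
    (1 + lam * h) ^+ j * (h * (r ^+ 2 * f j ^+ 2 / 2)) by field.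
  by rewrite ler_wpM2l// ler_wpM2l ?(ltW h0)// ler_pM2r// bge.
have GT : G T <= K ^+ 2 * X.
  rewrite /G /X mulr_sumr; apply: ler_sum_nat => j /andP[_ jN].
  have -> : K ^+ 2 * ((1 + lam * h) ^+ j * (h * f j ^+ 2)) =
    (1 + lam * h) ^+ j * (h * (f j ^+ 2 * K ^+ 2)) by ring.
  by rewrite ler_wpM2l// ler_wpM2l ?(ltW h0)// ler_wpM2l ?sqr_ge0// PT.
have C2G : C2 * G T <= r ^+ 2 / 8 * X.
  apply: le_trans (ler_wpM2l C20 GT) _; rewrite mulrA ler_wpM2r//.
  exact: le_trans X0X.
(* The weights cost [e^lam] and the time factor gains [e^{- kap lam T}], while the energy at T is a
   multiple of [X0], hence of [X]. *)
have FT : expR (- mu * T) * F lam T <= r ^+ 2 / 8 * X.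
  have := le_trans (F_le_energy lam T (ltW lam0))
    (ler_wpM2l (mulr_ge0 (ler0n _ 4) (expR_ge0 lam)) energy_le).
  move=> /(ler_wpM2l (expR_ge0 (- mu * T))) /le_trans; apply.
  have -> : expR (- mu * T) * (4 * expR lam * (expR ((m + 2) * T) *
      ((B + K ^+ 2) / 2) * X0)) =
    4 * expR (lam - kap * lam * T) * (expR ((m + 2) * T) * ((B + K ^+ 2) / 2)) * X0.
    have -> : lam - kap * lam * T = lam + - mu * T by rewrite /mu; ring.
    by rewrite expRD; ring.
  apply: le_trans (ler_wpM2r X00 cE) _; rewrite ler_wpM2l//.
  by rewrite divr_ge0 ?sqr_ge0.
have ? : r ^+ 2 / 4 * X0 <= r ^+ 2 / 4 * X.
  by rewrite ler_wpM2l// divr_ge0 ?sqr_ge0.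
lra.
Qed.

(** The quantity [(T - t) F0 + C V + eps G] is nondecreasing. Its first term is at least [T r^2 / 2]
    times the sum of the [f_j^2] at time 0 and vanishes at T; the choice of [eps] lets the source
    consume exactly half of that bound. *)
Lemma coarse_stability (n0 eps : R) : N.+1%:R <= n0 ->
  eps = T * r ^+ 2 / (4 * K ^+ 2) ->
  T * r ^+ 2 / 4 * (h * \sum_(0 <= j < N.+1) f j ^+ 2) <=
  (1 / 2 + T ^+ 2 * (n0 ^+ 4 / 2 + 1 / (4 * eps) + m ^+ 2 / 2 + 38)) * n0 ^+ 2 *
  (h * V T).
Proof.
move=> nn0 epsE.
have K20 : 0 < K ^+ 2 by rewrite exprn_gt0.
have eps0 : 0 < eps by rewrite epsE divr_gt0 ?mulr_gt0 ?exprn_gt0.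
set C := (_ + T ^+ 2 * _) * _.
pose F0 t := \sum_(0 <= j < N.+1) (b j t ^+ 2 / 2 - 19 * w j t ^+ 2).
pose G t := \sum_(0 <= j < N.+1) f j ^+ 2 * P j t.
have dG : diff_on T G (fun t => \sum_(0 <= j < N.+1) f j ^+ 2 * rho j t ^+ 2).
  by apply: diff_on_sum => j jN; apply: diff_onZ; exact: dP.
have dF : diff_on T F0 (fun t => \sum_(0 <= j < N.+1)
    (b j t * accel N (w ^~ t) (S t) j - 38 * (w j t * b j t))).
  apply: diff_on_sum => j jN.
  apply: diff_on_ext (diff_onB (diff_onM (diff_onX2 (db j jN)) (diff_on_cst 2^-1))
    (diff_onZ 19 (diff_onX2 (dw j (leqW jN))))) => // t _ /=.
  by field.
have := diff_on_le T0 (diff_onD (diff_onD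
  (diff_onM (diff_onB (diff_on_cst T) diff_on_id) dF) (diff_onZ C dV)) (diff_onZ eps dG)).
have pos (t : R) : t \in `]0, T[ -> 0 <= (0 - 1) * F0 t +
    (T - t) * (\sum_(0 <= j < N.+1)
      (b j t * accel N (w ^~ t) (S t) j - 38 * (w j t * b j t))) +
    C * (\sum_(0 <= j < N.+1) (b j.+1 t - b j t) ^+ 2) +
    eps * (\sum_(0 <= j < N.+1) f j ^+ 2 * rho j t ^+ 2).
  rewrite in_itv/= => /andP[t0 tT].
  have tau : (0 <= T - t) && (T - t <= T) by rewrite subr_ge0 gerBl !ltW.
  have := coarse_rate_ge N n0 m eps T (T - t) (w ^~ t) (b ^~ t) f (rho ^~ t) q
    (w0 t) (wN t) (b0 t) nn0 m0 eps0 tau qm.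
  rewrite -/C -/(F0 t) -/(S t); lra.
move=> /(_ pos); rewrite V0 !mulr0 subr0 subrr mul0r add0r addr0 /=.
have -> : G 0 = 0 by rewrite /G big1// => j _; rewrite P0 mulr0.
rewrite mulr0 addr0 => H.
set X := \sum_(0 <= j < N.+1) f j ^+ 2.
have FX : r ^+ 2 / 2 * X <= F0 0.
  rewrite /F0 /X mulr_sumr; apply: ler_sum_nat => j /andP[_ jN].
  rewrite wi ?(ltnW jN)// expr0n mulr0 subr0.
  by have := bge j jN; lra.
have GT : G T <= K ^+ 2 * X.
  rewrite /G /X mulr_sumr; apply: ler_sum_nat => j /andP[_ jN].
  by rewrite [leRHS]mulrC ler_wpM2l ?sqr_ge0// PT.
have eG : eps * G T <= T * r ^+ 2 / 4 * X.
  have -> : T * r ^+ 2 / 4 * X = eps * (K ^+ 2 * X).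
    by rewrite epsE; field; rewrite gt_eqF.
  by rewrite ler_wpM2l// ltW.
have TF : T * (r ^+ 2 / 2 * X) <= T * F0 0 by rewrite ler_wpM2l// ltW.
have : h * (T * r ^+ 2 / 4 * X) <= h * (C * V T) by rewrite ler_wpM2l ?(ltW h0)//; lra.
lra.
Qed.

(** Either [lam h <= (1 - kap) / 2] and the weighted functional applies, or
    [N + 1 <= 2 lam / (1 - kap)] and the coarse estimate does. *)
Lemma stability (kap lam : R) :
  1 / 2 <= kap -> kap < 1 -> 4 <= (1 - kap) * lam -> 16 * m ^+ 2 <= lam ->
  16 / ((1 - kap) * lam) * K ^+ 2 <= r ^+ 2 / 8 ->
  4 * expR (lam - kap * lam * T) * (expR ((m + 2) * T) * ((B + K ^+ 2) / 2)) <=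
    r ^+ 2 / 8 ->
  h * (\sum_(0 <= j < N.+1) f j ^+ 2) <=
  stability_constant T m K r kap lam * (A T + h * V T).
Proof.
move=> k12 k1 lk lm cK cE.
have c0 : 0 < 1 - kap by rewrite subr_gt0.
have lam0 : 0 < lam by rewrite -(pmulr_rgt0 _ c0); apply: lt_le_trans lk.
have r20 : 0 < r ^+ 2 by rewrite exprn_gt0.
have AT : 0 <= A T by rewrite -A0; apply: (diff_on_le T0 dA) => t _; exact: sqr_ge0.
have VT : 0 <= V T.
  rewrite -V0; apply: (diff_on_le T0 dV) => t _.
  by apply: sumr_ge0 => j _; exact: sqr_ge0.
have hV : 0 <= h * V T by rewrite mulr_ge0// ltW.
rewrite /stability_constant.
set n0 := 2 * lam / (1 - kap); set eps := T * r ^+ 2 / (4 * K ^+ 2).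
have n00 : 0 <= n0 by rewrite divr_ge0 ?mulr_ge0 ?(ltW lam0) ?(ltW c0).
set X := h * _; set C := (_ + T ^+ 2 * _) * _.
have C0 : 0 <= C.
  have e0 : 0 <= 1 / (4 * eps).
    apply: divr_ge0 => //; apply: mulr_ge0 => //; apply: divr_ge0.
      by rewrite mulr_ge0 ?(ltW T0) ?(ltW r20).
    by rewrite mulr_ge0 ?sqr_ge0.
  have ? : 0 <= n0 ^+ 4 by exact: exprn_ge0.
  have ? : 0 <= m ^+ 2 by exact: sqr_ge0.
  rewrite /C mulr_ge0 ?sqr_ge0// addr_ge0//.
  by apply: mulr_ge0; [exact: sqr_ge0|lra].
have e0 := expR_gt0 lam.
have a1 : 0 <= 4 / r ^+ 2 * (expR lam * (1 + n0)) * (A T + h * V T).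
  rewrite mulr_ge0 ?addr_ge0// mulr_ge0 ?divr_ge0 ?(ltW r20)//.
  by rewrite mulr_ge0 ?(ltW e0)// addr_ge0.
have a2 : 0 <= 4 / (T * r ^+ 2) * C * (A T + h * V T).
  by rewrite mulr_ge0 ?addr_ge0// mulr_ge0// divr_ge0// mulr_ge0 ?(ltW T0) ?(ltW r20).
rewrite mulrDl.
have [sh|/ltW sh] := leP (lam * h) ((1 - kap) / 2).
  have H := fine_stability kap lam k12 k1 lk lm sh cK cE.
  rewrite -/n0 -/X in H.
  suff : X <= 4 / r ^+ 2 * (expR lam * (1 + n0)) * (A T + h * V T) by lra.
  have -> : X = 4 / r ^+ 2 * (r ^+ 2 / 4 * X) by field; rewrite gt_eqF.
  rewrite -[leRHS]mulrA; apply: ler_wpM2l; first by rewrite divr_ge0 ?(ltW r20).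
  apply: (le_trans H).
  have ? : 0 <= expR lam * n0 * A T by rewrite mulr_ge0// mulr_ge0 ?(ltW e0).
  have ? : 0 <= expR lam * (h * V T) by rewrite mulr_ge0 ?(ltW e0).
  lra.
have nn0 : N.+1%:R <= n0.
  rewrite /n0 ler_pdivlMr//.
  have hN := hstepK N (R := R).
  have : N.+1%:R * ((1 - kap) / 2) <= N.+1%:R * (lam * h) by rewrite ler_wpM2l.
  have -> : N.+1%:R * (lam * h) = lam * (h * N.+1%:R) by ring.
  by rewrite hN; lra.
have H := coarse_stability n0 eps nn0 erefl.
rewrite -/C -/X in H.
suff : X <= 4 / (T * r ^+ 2) * C * (A T + h * V T) by lra.
have -> : X = 4 / (T * r ^+ 2) * (T * r ^+ 2 / 4 * X).
  by field; rewrite !gt_eqF.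
rewrite -[leRHS]mulrA; apply: ler_wpM2l; first by rewrite divr_ge0// mulr_ge0 ?(ltW T0) ?(ltW r20).
apply: (le_trans H); apply: ler_wpM2l => //; lra.
Qed.

End stability.

(** Each of the four requirements holds beyond a threshold [l1], ..., [l4], and [lam] is their sum.
    For the last one, [kap T > 1] makes the exponent negative. *)
Lemma exists_rate {R : realType} (T m K r kap M : R) : 1 < kap * T -> kap < 1 ->
  0 < r -> 0 <= M ->
  exists lam : R, [/\ 4 <= (1 - kap) * lam, 16 * m ^+ 2 <= lam,
    16 / ((1 - kap) * lam) * K ^+ 2 <= r ^+ 2 / 8 &
    4 * expR (lam - kap * lam * T) * M <= r ^+ 2 / 8].
Proof.
move=> kT k1 r0 M0.
have c0 : 0 < 1 - kap by rewrite subr_gt0.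
have d0 : 0 < kap * T - 1 by rewrite subr_gt0.
have r20 : 0 < r ^+ 2 by rewrite exprn_gt0.
set c := 1 - kap in c0 *; set d := kap * T - 1 in d0.
pose l1 := 4 / c; pose l2 := 16 * m ^+ 2; pose l3 := 128 * K ^+ 2 / (c * r ^+ 2).
pose l4 := 32 * M / (r ^+ 2 * d).
have l10 : 0 < l1 by rewrite divr_gt0.
have l20 : 0 <= l2 by rewrite mulr_ge0 ?sqr_ge0.
have l30 : 0 <= l3 by apply: divr_ge0; rewrite mulr_ge0 ?sqr_ge0 ?(ltW c0).
have l40 : 0 <= l4 by apply: divr_ge0; rewrite mulr_ge0 ?(ltW r20) ?(ltW d0).
pose lam := l1 + l2 + l3 + l4.
have lam0 : 0 < lam by rewrite /lam; lra.
have cl0 : 0 < c * lam by rewrite mulr_gt0.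
have dl0 : 0 < d * lam by rewrite mulr_gt0.
exists lam; split.
- have : c * l1 <= c * lam by rewrite ler_pM2l// /lam; lra.
  by have -> : c * l1 = 4 by rewrite /l1; field; rewrite gt_eqF.
- by rewrite -/l2 /lam; lra.
- rewrite mulrAC ler_pdivrMr//.
  have : c * r ^+ 2 / 8 * l3 <= c * r ^+ 2 / 8 * lam.
    by apply: ler_wpM2l; [apply: divr_ge0 => //; rewrite mulr_ge0 ?sqr_ge0 ?(ltW c0) ?(ltW d0)|rewrite /lam; lra].
  have -> : c * r ^+ 2 / 8 * l3 = 16 * K ^+ 2 by rewrite /l3; field; rewrite !gt_eqF.
  lra.
- have -> : lam - kap * lam * T = - (d * lam) by rewrite /d; ring.
  (* The crude bound [e^{-x} <= 1/x] suffices and gives an explicit threshold. *)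
  have e1 : expR (- (d * lam)) <= (d * lam)^-1.
    rewrite expRN lef_pV2 ?posrE ?expR_gt0//.
    by apply: le_trans (expR_ge1Dx _); rewrite lerDr.
  have : 4 * expR (- (d * lam)) * M <= 4 * (d * lam)^-1 * M.
    by rewrite ler_wpM2r// ler_wpM2l.
  move/le_trans; apply; rewrite mulrAC ler_pdivrMr//.
  have : r ^+ 2 * d / 8 * l4 <= r ^+ 2 * d / 8 * lam.
    by apply: ler_wpM2l; [apply: divr_ge0 => //; rewrite mulr_ge0 ?sqr_ge0 ?(ltW c0) ?(ltW d0)|rewrite /lam; lra].
  have -> : r ^+ 2 * d / 8 * l4 = 4 * M by rewrite /l4; field; rewrite !gt_eqF.
  lra.
Qed.

(** * Integrals and norms in time *)

Section integration.
Context {R : realType} (T : R).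
Hypothesis T0 : 0 < T.
Notation mu := (@lebesgue_measure R).
Implicit Types u v k : R -> R.

Lemma within_integrable k : {within `[0, T], continuous k} ->
  mu.-integrable `[0, T] (EFin \o k).
Proof. by move=> ck; apply: continuous_compact_integrable => //; exact: segment_compact. Qed.

Lemma diff_on_integral k : {within `[0, T], continuous k} ->
  diff_on T (fun t => \int[mu]_(s in `[0, t]) k s) k.
Proof.
move=> ck; have ik := within_integrable k ck.
split; first exact: parameterized_integral_continuous (ltW T0) ik.
move=> t tT; move: (tT); rewrite in_itv/= => /andP[t0 tT'].
have kt : {for t, continuous k}.
  by have [h _ _] := (continuous_within_itvP _ T0).1 ck; exact: h.
have [dk kE] := continuous_FTC1_closed tT' ik t0 kt.
by apply: (DeriveDef dk); rewrite -kE derive1E.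
Qed.

Lemma W11_within u v : W11_derivative T u v -> {within `[0, T], continuous u}.
Proof.
move=> [iv uE].
have cv := parameterized_integral_continuous (ltW T0) iv.
have cc : {within `[0, T], continuous (fun t => u 0 + \int[mu]_(s in `[0, t]) v s)}.
  by move=> x; apply: cvgD; [exact: cvg_cst|exact: cv].
apply: within_ext cc => x xT; exact/esym/uE.
Qed.

(** A weak derivative that agrees almost everywhere with a continuous function is classical: [u] is
    also the indefinite integral of [k], to which the fundamental theorem of calculus applies. *)
Lemma W11_diff_on u v k : W11_derivative T u v -> {within `[0, T], continuous k} ->
  {ae mu, forall t, t \in `]0, T[ -> v t = k t} -> diff_on T u k.
Proof.
move=> [iv uE] ck vk; have ik := within_integrable k ck.
apply: diff_on_ext (diff_onD (diff_on_cst (u 0)) (diff_on_integral k ck)) => t tT;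
  last by rewrite add0r.
rewrite /= [RHS]uE//; congr (_ + _); rewrite /Rintegral; congr fine; apply/esym.
have itv_sub a b : [set` Interval (BSide a 0) (BSide b t)] `<=` `[0, T].
  move=> x /=; rewrite !in_itv/= in tT *; case/andP: tT => _ tT.
  by case: a; case: b => /= /andP[x0 xt]; apply/andP; split;
    first [by []|exact: ltW|exact: le_trans xt tT|exact: le_trans (ltW xt) tT].
have mS (F : R -> R) a b : mu.-integrable `[0, T] (EFin \o F) ->
    measurable_fun [set` Interval (BSide a 0) (BSide b t)] F.
  move=> iF; apply: (@measurable_funS _ _ _ _ `[0, T]%classic).
  - exact: measurable_itv.
  - exact: itv_sub.
  - by apply/measurable_EFinP; exact: (measurable_int _ iF).
have itvE (F : R -> R) : mu.-integrable `[0, T] (EFin \o F) ->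
    (* The end points are discarded because [v] and [k] are compared on the open interval only. *)
    (\int[mu]_(x in `[0%R, t]) (F x)%:E = \int[mu]_(x in `]0%R, t[) (F x)%:E)%E.
  move=> iF; rewrite -integral_itv_obnd_cbnd; last by apply/measurable_EFinP; exact: mS.
  by rewrite integral_itv_bndo_bndc//; apply/measurable_EFinP; exact: mS.
rewrite !itvE//; apply: ae_eq_integral => //; [by apply/measurable_EFinP; exact: mS|by apply/measurable_EFinP; exact: mS|].
move: vk; apply: filterS; first exact: (ae_filter_ringOfSetsType mu).
move=> x vkx; rewrite /= in_itv/= => /andP[x0 xt].
congr EFin; apply/vkx; rewrite in_itv/= x0/=.
by apply: lt_le_trans xt _; move: tT; rewrite in_itv/= => /andP[].
Qed.

Lemma W11_derivativeB u1 u2 v1 v2 : W11_derivative T u1 v1 -> W11_derivative T u2 v2 ->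
  W11_derivative T (fun t => u1 t - u2 t) (fun t => v1 t - v2 t).
Proof.
move=> [i1 E1] [i2 E2]; split.
  have mI : measurable (`[0, T]%classic : set (measurableTypeR R)).
    exact: measurable_itv.
  have := integrableB mI i1 i2.
  by apply: eq_integrable => // x _ /=; rewrite EFinB.
move=> t tT; rewrite E1// E2//.
have sub : `[0, t] `<=` `[0, T].
  by move=> x /=; rewrite !in_itv/= in tT *; case/andP: tT => ? ? /andP[-> /le_trans]; apply.
have iS v : mu.-integrable `[0, T] (EFin \o v) -> mu.-integrable `[0, t] (EFin \o v).
  apply: (@integrableS _ (measurableTypeR R) R mu `[0, T]%classic `[0, t]%classic (EFin \o v)).
  - exact: measurable_itv.
  - exact: measurable_itv.
  - exact: sub.
by rewrite RintegralB//; [ring|exact: iS|exact: iS].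
Qed.

(** Only the values of [u] on the open interval enter, so [u] may be built from [derive1], whose
    values at the end points are not controlled. *)
Lemma normL2t_within u k : {within `[0, T], continuous k} ->
  (forall t, t \in `]0, T[ -> u t ^+ 2 = k t) ->
  (forall t, 0 <= k t) ->
  normL2t T u = (Num.sqrt (\int[mu]_(t in `[0, T]) k t))%:E.
Proof.
move=> ck uk k0; have ik := within_integrable _ ck.
have I0 : 0 <= \int[mu]_(t in `[0, T]) k t by exact: Rintegral_ge0.
rewrite /normL2t unlock -powR12_sqrt// -poweR_EFin; congr (_ `^ _)%E.
rewrite /Rintegral fineK; last exact: integrable_fin_num.
have mk b b' : measurable_fun [set` Interval (BSide b 0) (BSide b' T)] k.
  apply: (@measurable_funS _ _ _ _ `[0, T]%classic).
  - exact: measurable_itv.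
  - by move=> x /=; rewrite !in_itv/=; case: b; case: b' => /= /andP[? ?];
      apply/andP; split; first [by []|exact: ltW].
  - by apply/measurable_EFinP; exact: (measurable_int _ ik).
rewrite -[RHS]integral_itv_obnd_cbnd; last by apply/measurable_EFinP; exact: mk.
rewrite -[RHS]integral_itv_bndo_bndc; last by apply/measurable_EFinP; exact: mk.
rewrite [RHS]integral_mkcond; apply: eq_integral => x _ /=.
rewrite !patchE; case: ifPn => /= [xT|_]; last by rewrite normr0 powR0// pnatr_eq0.
by rewrite inE/= in xT; rewrite powR_mulrn// real_normK ?num_real// uk.
Qed.

Lemma diff_on_derive2 u v k t : diff_on T u v -> diff_on T v k -> t \in `]0, T[ ->
  derive1n 2 u t = k t.
Proof.
move=> uv vk tT; rewrite /= derive1E.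
suff h : is_derive t 1 (derive1 u) (k t) by rewrite derive_val.
have [_ /(_ _ tT)] := vk; apply: near_eq_is_derive; rewrite ?oner_neq0//.
have : \forall s \near t, s \in `]0, T[ by exact: near_in_itvoo.
by apply: filterS => s sT; rewrite (diff_on_derive1 uv).
Qed.

Lemma within_Linfh N (u : nat -> R -> R) :
  (forall j, (1 <= j <= N)%N -> {within `[0, T], continuous (u j)}) ->
  {within `[0, T], continuous (fun t => Linfh N (u ^~ t))}.
Proof.
move=> cu; rewrite /Linfh.
have : {in index_iota 1 N.+1, forall j, {within `[0, T], continuous (u j)}}.
  by move=> j; rewrite mem_index_iota ltnS => /cu.
elim: (index_iota 1 N.+1) => [_|j s IH js].
  apply: (@within_ext _ T (fun=> 0)) (diff_on_continuous (diff_on_cst 0)).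
  by move=> t _; rewrite big_nil.
have cs : {within `[0, T], continuous (fun t => \big[Num.max/0]_(i <- s) `|u i t|)}.
  by apply: IH => i si; apply: js; rewrite inE si orbT.
have cj : {within `[0, T], continuous (fun t => `|u j t|)}.
  by move=> x; apply: cvg_norm; apply: js; rewrite inE eqxx.
apply: (@within_ext _ T (fun t => Num.max `|u j t| (\big[Num.max/0]_(i <- s) `|u i t|))).
  by move=> t _; rewrite big_cons.
by move=> x; exact: (continuous_max (cj x) (cs x)).
Qed.

End integration.

Lemma le_Linfh {R : realType} N (v : nat -> R) j : (1 <= j <= N)%N -> `|v j| <= Linfh N v.
Proof.
move=> jN; apply: (le_bigmax_seq 0 j xpredT (fun i => `|v i|)) => //.
by rewrite mem_index_iota ltnS.
Qed.

Lemma Linfh_ge0 {R : realType} N (v : nat -> R) : 0 <= Linfh N v.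
Proof. by rewrite /Linfh; elim/big_ind : _ => // x y x0 y0; rewrite le_max x0. Qed.

(** * Componentwise consequences of the bound in [H^1(0,T; L_h^oo)] *)

Section H1_norm.
Context {R : realType} (T K : R) (N : nat) (y yd : nat -> R -> R).
Notation mu := (@lebesgue_measure R).
Hypotheses (T0 : 0 < T) (K0 : 0 < K)
  (yE : forall j, (1 <= j <= N)%N -> diff_on T (y j) (yd j))
  (cyd : forall j, (1 <= j <= N)%N -> {within `[0, T], continuous (yd j)})
  (yK : (normH1Linfh N T y <= K%:E)%E).

Let within_sqr (u : R -> R) : {within `[0, T], continuous u} ->
  {within `[0, T], continuous (fun t => u t ^+ 2)}.
Proof. by move=> cu x; apply: cvgM; exact: cu. Qed.

(** Stated with a separate [M] so as to cover both halves of the norm: for the second one, [M] is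
    written with [derive1] and matches [u] inside the interval only. *)
Let norm_part_le (u : nat -> R -> R) (M : R -> R) :
  (forall j, (1 <= j <= N)%N -> {within `[0, T], continuous (u j)}) ->
  (forall t, t \in `]0, T[ -> M t = Linfh N (u ^~ t)) ->
  (normL2t T M <= K%:E)%E ->
  forall j, (1 <= j <= N)%N -> \int[mu]_(t in `[0, T]) u j t ^+ 2 <= K ^+ 2.
Proof.
move=> cu MuE MK j jN.
have cM := within_sqr _ (within_Linfh T N u cu).
move: MK; rewrite (normL2t_within T M _ cM) => [|t tT|t]; last 2 first.
- by rewrite MuE.
- exact: sqr_ge0.
rewrite lee_fin => /(lerXn2r 2); rewrite !nnegrE sqrtr_ge0 (ltW K0) => /(_ isT isT).
rewrite sqr_sqrtr; last by apply: Rintegral_ge0 => t _; exact: sqr_ge0.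
apply: le_trans; apply: le_Rintegral => //.
- exact: within_integrable _ _ (within_sqr _ (cu j jN)).
- exact: within_integrable _ _ cM.
- move=> t _; rewrite -[leLHS]real_normK ?num_real// lerXn2r ?nnegrE ?Linfh_ge0//.
  exact: (le_Linfh N (u ^~ t)).
Qed.

Let H1_parts : (normL2t T (fun t => Linfh N (y ^~ t)) <= K%:E)%E /\
  (normL2t T (fun t => Linfh N (fun j => derive1 (y j) t)) <= K%:E)%E.
Proof.
move: yK; rewrite /normH1Linfh.
set a := normL2t _ _; set b := normL2t _ _ => abK.
have a0 : (0 <= a)%E by exact: Lnorm_ge0.
have b0 : (0 <= b)%E by exact: Lnorm_ge0.
have le c : (0 <= c)%E -> (c `^ 2 <= a `^ 2 + b `^ 2)%E -> (c <= K%:E)%E.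
  move=> c0 cab; apply: le_trans abK.
  have -> : c = ((c `^ 2) `^ 2^-1)%E by rewrite -poweRrM divff// poweRe1.
  have i2 : 0 <= 2^-1 :> R by rewrite invr_ge0.
  by apply: (gt0_ler_poweR i2) => //;
    rewrite in_itv/= leey andbT ?adde_ge0 ?poweR_ge0.
by split; apply: le => //; [apply: leeDl|apply: leeDr]; exact: poweR_ge0.
Qed.

Lemma integral_sqr_le j : (1 <= j <= N)%N ->
  \int[mu]_(t in `[0, T]) y j t ^+ 2 <= K ^+ 2.
Proof.
apply: norm_part_le H1_parts.1 _ => // i iN.
exact: diff_on_continuous (yE i iN).
Qed.

Lemma integral_derive_sqr_le j : (1 <= j <= N)%N ->
  \int[mu]_(t in `[0, T]) yd j t ^+ 2 <= K ^+ 2.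
Proof.
apply: norm_part_le H1_parts.2 _ => // t tT.
rewrite /Linfh; apply: eq_big_nat => i iN; congr `|_|.
by rewrite (diff_on_derive1 (yE i iN)).
Qed.

(** Trace inequality. The derivative of [(T - t) y^2 + 2 int y^2 + T^2 int y'^2] is [(y + (T - t)
    y')^2 + (T^2 - (T - t)^2) y'^2], hence nonnegative. This supplies the upper bound on the initial
    data that the energy estimate requires. *)
Lemma initial_value_le j : (1 <= j <= N)%N ->
  y j 0 ^+ 2 <= (2 + T ^+ 2) * K ^+ 2 / T.
Proof.
move=> jN.
have cy := within_sqr _ (diff_on_continuous (yE j jN)).
have cy' := within_sqr _ (cyd j jN).
have := diff_on_le T0 (diff_onD (diff_onD
  (diff_onM (diff_onB (diff_on_cst T) diff_on_id) (diff_onX2 (yE j jN)))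
  (diff_onZ 2 (diff_on_integral T T0 _ cy)))
  (diff_onZ (T ^+ 2) (diff_on_integral T T0 _ cy'))).
have pos (t : R) : t \in `]0, T[ -> 0 <= (0 - 1) * y j t ^+ 2 +
    (T - t) * (2 * (y j t * yd j t)) + 2 * y j t ^+ 2 + T ^+ 2 * yd j t ^+ 2.
  rewrite in_itv/= => /andP[t0 tT].
  have ? := sqr_ge0 (y j t + (T - t) * yd j t).
  have ? : (T - t) ^+ 2 * yd j t ^+ 2 <= T ^+ 2 * yd j t ^+ 2.
    by rewrite ler_wpM2r ?sqr_ge0// lerXn2r ?nnegrE ?subr_ge0 ?gerBl ?ltW.
  lra.
move=> /(_ pos); rewrite subrr mul0r subr0 add0r set_itv1 !Rintegral_set1 !mulr0 !addr0.
have := integral_sqr_le j jN; have := integral_derive_sqr_le j jN.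
set I1 := \int[mu]_(t in _) _; set I2 := \int[mu]_(t in _) _ => h1 h2 h3.
rewrite ler_pdivlMr// mulrC (le_trans h3)//.
have ? : T ^+ 2 * I1 <= T ^+ 2 * K ^+ 2 by rewrite ler_wpM2l ?sqr_ge0.
lra.
Qed.

End H1_norm.

(** * Solutions of the semi-discrete wave equation *)

Section solutions.
Context {R : realType} (N : nat) (T : R).
Hypothesis T0 : 0 < T.
Notation mu := (@lebesgue_measure R).
Local Notation h := (hstep R N).

(** Extension by zero: values off the interior grid are arbitrary, whereas the abstract estimates
    sum from index 0 and ask for zeros at 0 and [N + 1]. *)
Definition interior (u : nat -> R) j : R := if (1 <= j <= N)%N then u j else 0.

(** The first derivatives are chosen simultaneously for all [j], to form grid functions at each
    time; the second ones enter only through the equation and stay existential. *)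
Lemma solution_derivatives q y0 y1 g g0 g1 y : is_solution N T q y0 y1 g g0 g1 y ->
  exists yd : nat -> R -> R, forall j, (1 <= j <= N)%N -> exists ydd : R -> R,
    [/\ W11_derivative T (y j) (yd j), W11_derivative T (yd j) ydd,
        y j 0 = y0 j, yd j 0 = y1 j &
        {ae mu, forall t, t \in `]0, T[ ->
           ydd t - laplh N (y ^~ t) j + q j * y j t = g j t}].
Proof.
move=> [_ _ H].
suff /choice[yd yd_P] : forall j, exists yd : R -> R, (1 <= j <= N)%N ->
    exists ydd : R -> R, [/\ W11_derivative T (y j) yd, W11_derivative T yd ydd,
      y j 0 = y0 j, yd 0 = y1 j &
      {ae mu, forall t, t \in `]0, T[ ->
         ydd t - laplh N (y ^~ t) j + q j * y j t = g j t}].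
  by exists yd.
move=> j; case: (boolP (1 <= j <= N)%N) => [/H[yd ydP]|_]; first by exists yd.
by exists (fun=> 0).
Qed.

Context (p q y0 y1 : nat -> R) (g : nat -> R -> R) (g0 g1 : R -> R).
Context (yp yq ypd yqd : nat -> R -> R).
Hypotheses (yp_sol : is_solution N T p y0 y1 g g0 g1 yp)
  (yq_sol : is_solution N T q y0 y1 g g0 g1 yq).
Hypotheses
  (ypdP : forall j, (1 <= j <= N)%N -> exists ydd : R -> R,
    [/\ W11_derivative T (yp j) (ypd j), W11_derivative T (ypd j) ydd,
        yp j 0 = y0 j, ypd j 0 = y1 j &
        {ae mu, forall t, t \in `]0, T[ ->
           ydd t - laplh N (yp ^~ t) j + p j * yp j t = g j t}])
  (yqdP : forall j, (1 <= j <= N)%N -> exists ydd : R -> R,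
    [/\ W11_derivative T (yq j) (yqd j), W11_derivative T (yqd j) ydd,
        yq j 0 = y0 j, yqd j 0 = y1 j &
        {ae mu, forall t, t \in `]0, T[ ->
           ydd t - laplh N (yq ^~ t) j + q j * yq j t = g j t}]).

Let z j t : R := yq j t - yp j t.
Let w j t : R := interior (fun i => yqd i t - ypd i t) j.
(** The second derivative of [z] as read off from the difference of the two equations. *)
Let k j t : R := laplh N (z ^~ t) j - q j * z j t - (q j - p j) * yp j t.
Let b j t : R := interior (k ^~ t) j.
Let f j : R := interior (fun i => p i - q i) j.

Lemma diff_on_solution j : (1 <= j <= N)%N -> diff_on T (yp j) (ypd j).
Proof.
move=> jN; have [ydd [H1 H2 _ _ _]] := ypdP j jN.
by apply: W11_diff_on T0 _ _ _ H1 (W11_within T T0 _ _ H2) _; exact: aeW.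
Qed.

Lemma within_solution_derivative j : (1 <= j <= N)%N ->
  {within `[0, T], continuous (ypd j)}.
Proof.
by move=> jN; have [ydd [_ H2 _ _ _]] := ypdP j jN; exact: W11_within H2.
Qed.

Lemma diff_on_difference j : (j <= N.+1)%N -> diff_on T (z j) (w j).
Proof.
move=> jN; case: (boolP (1 <= j <= N)%N) => [jI|jO].
  have [yqdd [Q1 Q2 _ _ _]] := yqdP j jI.
  have dyq : diff_on T (yq j) (yqd j).
    by apply: W11_diff_on T0 _ _ _ Q1 (W11_within T T0 _ _ Q2) _; exact: aeW.
  apply: diff_on_ext (diff_onB dyq (diff_on_solution j jI)) => // t _.
  by rewrite /w /interior jI.
apply: diff_on_ext (diff_on_cst 0) => t tT; last by rewrite /w /interior (negbTE jO).
have [P0 P1 _] := yp_sol; have [Q0 Q1 _] := yq_sol.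
have /orP[/eqP->|/eqP->] : (j == 0%N) || (j == N.+1) by move: jO jN; lia.
  by rewrite /z P0// Q0// subrr.
by rewrite /z P1// Q1// subrr.
Qed.

Let dk j : (1 <= j <= N)%N -> diff_on T (k j)
  (fun t => laplh N (w ^~ t) j - q j * w j t - (q j - p j) * ypd j t).
Proof.
move=> jI; have [j1 jN] := andP jI.
have dz := diff_on_difference.
have dl : diff_on T (fun t => laplh N (z ^~ t) j) (fun t => laplh N (w ^~ t) j).
  have dj : (j.-1 <= N.+1)%N by lia.
  have := diff_onM (diff_onD (diff_onB (dz j.+1 jN) (diff_onZ 2 (dz j (leqW jN))))
    (dz j.-1 dj)) (diff_on_cst (h ^+ 2)^-1).
  by apply: diff_on_ext => // t _; rewrite mulr0 addr0.
exact: diff_onB (diff_onB dl (diff_onZ _ (dz j (leqW jN)))) (diff_onZ _ (diff_on_solution j jI)).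
Qed.

(** The common source [g] cancels in the difference, so that the second derivative of [z] has the
    continuous representative [k] although those of [yq] and [yp] need not be continuous. *)
Lemma diff_on_velocity j : (j <= N.+1)%N -> diff_on T (w j) (b j).
Proof.
move=> jN; case: (boolP (1 <= j <= N)%N) => [jI|jO]; last first.
  by apply: diff_on_ext (diff_on_cst 0) => t tT; rewrite /w /b /interior (negbTE jO).
have [yqdd [_ Q2 _ _ Qe]] := yqdP j jI; have [ypdd [_ P2 _ _ Pe]] := ypdP j jI.
suff : diff_on T (fun t => yqd j t - ypd j t) (k j).
  by apply: diff_on_ext => t _; rewrite /w /b /interior jI.
apply: W11_diff_on T0 _ _ _ (W11_derivativeB T _ _ _ _ Q2 P2)
  (diff_on_continuous (dk j jI)) _.
move: Qe Pe; apply: filterS2; first exact: (ae_filter_ringOfSetsType mu).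
move=> t Qe Pe tT; have {}Qe := Qe tT; have {}Pe := Pe tT.
have -> : yqdd t = g j t + laplh N (yq ^~ t) j - q j * yq j t by rewrite -Qe; ring.
have -> : ypdd t = g j t + laplh N (yp ^~ t) j - p j * yp j t by rewrite -Pe; ring.
rewrite /k /z /laplh; ring.
Qed.

Lemma diff_on_acceleration j : (j <= N)%N -> diff_on T (b j)
  (fun t => accel N (w ^~ t)
     (fun i => f i * interior (ypd ^~ t) i - interior q i * w i t) j).
Proof.
move=> jN; case: j jN => [_|j jN].
  apply: diff_on_ext (diff_on_cst 0) => t _; first by rewrite /b /interior.
  by rewrite /accel /f /interior /= subrr !mul0r subrr addr0.
apply: diff_on_ext (dk j.+1 jN) => t _; first by rewrite /b /interior jN.
rewrite /accel /f /interior jN /laplh /dplush /=; field; exact: hstep_neq0.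
Qed.

Lemma velocity_initial j : (j <= N.+1)%N -> w j 0 = 0.
Proof.
rewrite /w /interior; case: ifPn => // jI _.
have [? [_ _ _ -> _]] := yqdP j jI; have [? [_ _ _ -> _]] := ypdP j jI.
by rewrite subrr.
Qed.

(** At time 0 the difference [z] vanishes on the whole grid, boundary included, so only the
    potential term of [k] remains. This is where [q - p] becomes visible. *)
Lemma acceleration_initial j : b j 0 = interior (fun i => (p i - q i) * y0 i) j.
Proof.
rewrite /b /interior; case: ifPn => // jI.
have z0 i : (i <= N.+1)%N -> z i 0 = 0.
  move=> iN; have T00 : (0 : R) \in `[0, T] by rewrite in_itv/= lexx ltW.
  have [P0 P1 _] := yp_sol; have [Q0 Q1 _] := yq_sol.
  case: (boolP (1 <= i <= N)%N) => [iI|iO].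
    have [? [_ _ e1 _ _]] := yqdP i iI; have [? [_ _ e2 _ _]] := ypdP i iI.
    by rewrite /z e1 e2 subrr.
  have /orP[/eqP->|/eqP->] : (i == 0%N) || (i == N.+1) by move: iO iN; lia.
    by rewrite /z P0// Q0// subrr.
  by rewrite /z P1// Q1// subrr.
have [? [_ _ e2 _ _]] := ypdP j jI.
have [j1 jN] := andP jI.
rewrite /k /laplh e2 !z0; [ring|lia|lia|lia].
Qed.

Context (m K r : R).
Hypotheses (m0 : 0 < m) (K0 : 0 < K) (r0 : 0 < r) (T1 : 1 < T)
  (qm : Linfh N q <= m) (ypK : (normH1Linfh N T yp <= K%:E)%E)
  (y0r : forall j, (1 <= j <= N)%N -> r <= `|y0 j|).

Let flux2 t : R := dplush N (w ^~ t) N ^+ 2.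
Let visc2 t : R := h * \sum_(0 <= j < N.+1) (b j.+1 t - b j t) ^+ 2.

Let cw2 : {within `[0, T], continuous flux2}.
Proof.
suff cw : {within `[0, T], continuous (fun t => dplush N (w ^~ t) N)}.
  by move=> x; apply: cvgM; exact: cw.
have H := diff_onM (diff_onB (diff_on_velocity N.+1 (leqnn _))
  (diff_on_velocity N (leqnSn _))) (diff_on_cst h^-1).
exact: diff_on_continuous H.
Qed.

Let cb j : (j <= N.+1)%N -> {within `[0, T], continuous (b j)}.
Proof.
rewrite leq_eqVlt => /predU1P[->|jN]; last exact: diff_on_continuous (diff_on_acceleration j jN).
apply: (@within_ext _ T (fun=> 0)) (diff_on_continuous (diff_on_cst 0)) => t _.
by rewrite /b /interior ltnn andbF.
Qed.

Let cv2 : {within `[0, T], continuous visc2}.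
Proof.
suff H n : (n <= N.+1)%N -> {within `[0, T], continuous
    (fun t => \sum_(0 <= j < n) (b j.+1 t - b j t) ^+ 2)}.
  by move=> x; apply: cvgM; [exact: cvg_cst|exact: H].
elim: n => [_|n IH nN].
  by apply: (@within_ext _ T (fun=> 0)) (diff_on_continuous (diff_on_cst 0)) => t _;
    rewrite big_geq.
have cd : {within `[0, T], continuous (fun t => b n.+1 t - b n t)}.
  by move=> x; apply: cvgB; apply: cb => //; exact: ltnW.
have cS : {within `[0, T], continuous (fun t => \sum_(0 <= j < n) (b j.+1 t - b j t) ^+ 2
    + (b n.+1 t - b n t) ^+ 2)}.
  by move=> x; apply: cvgD; [exact: IH (ltnW nN) x|apply: cvgM; exact: cd].
by apply: within_ext cS => t _; rewrite big_nat_recr.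
Qed.

Lemma stability_of_solutions (kap lam : R) :
  1 / 2 <= kap -> kap < 1 -> 4 <= (1 - kap) * lam -> 16 * m ^+ 2 <= lam ->
  16 / ((1 - kap) * lam) * K ^+ 2 <= r ^+ 2 / 8 ->
  4 * expR (lam - kap * lam * T) *
    (expR ((m + 2) * T) * (((2 + T ^+ 2) * K ^+ 2 / T + K ^+ 2) / 2)) <= r ^+ 2 / 8 ->
  h * (\sum_(0 <= j < N.+1) f j ^+ 2) <= stability_constant T m K r kap lam *
    (\int[mu]_(t in `[0, T]) flux2 t + \int[mu]_(t in `[0, T]) visc2 t).
Proof.
move=> k12 k1 lk lm cK cE.
have h0 := hstep_gt0 (R := R) N.
(* [visc2] carries the factor [h] of the discrete norm, while the abstract estimate uses a primitive
   of the bare sum. *)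
have dV : diff_on T (fun t => h^-1 * \int[mu]_(s in `[0, t]) visc2 s)
    (fun t => \sum_(0 <= j < N.+1) (b j.+1 t - b j t) ^+ 2).
  apply: diff_on_ext (diff_onZ h^-1 (diff_on_integral T T0 _ cv2)) => // t _.
  by rewrite /visc2 mulrA mulVf ?mul1r// hstep_neq0.
have -> : \int[mu]_(t in `[0, T]) visc2 t =
    h * (h^-1 * \int[mu]_(t in `[0, T]) visc2 t).
  by rewrite mulrA mulfV ?mul1r// hstep_neq0.
have interior_out u : interior u N.+1 = 0 by rewrite /interior ltnn andbF.
have int0 : \int[mu]_(s in `[(0 : R), 0]) flux2 s = 0.
  by rewrite set_itv1 Rintegral_set1.
pose rho j t : R := interior (ypd ^~ t) j.
have crho j : {within `[0, T], continuous (fun t => rho j t ^+ 2)}.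
  case: (boolP (1 <= j <= N)%N) => jI.
    have cy := within_solution_derivative j jI.
    have cy2 : {within `[0, T], continuous (fun t => ypd j t ^+ 2)}.
      by move=> x; apply: cvgM; exact: cy.
    by apply: within_ext cy2 => t _; rewrite /rho /interior jI.
  apply: (@within_ext _ T (fun=> 0)) (diff_on_continuous (diff_on_cst 0)) => t _.
  by rewrite /rho /interior (negbTE jI) expr0n.
apply: (stability N T m K r ((2 + T ^+ 2) * K ^+ 2 / T) w b rho f (interior q)
  (fun t => \int[mu]_(s in `[0, t]) flux2 s)
  (fun t => h^-1 * \int[mu]_(s in `[0, t]) visc2 s)
  (fun j t => \int[mu]_(s in `[0, t]) rho j s ^+ 2)) => //.
- exact: ltW.
- by move=> t; exact: interior_out.
- by move=> t; exact: interior_out.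
- move=> j jN; rewrite /interior; case: ifPn => [jI|_]; last by rewrite normr0 ltW.
  exact: le_trans (le_Linfh N q j jI) qm.
- exact: diff_on_velocity.
- exact: diff_on_acceleration.
- exact: velocity_initial.
- move=> j jN; rewrite acceleration_initial /f /interior; case: ifPn => [jI|_].
    rewrite mulrC exprMn ler_wpM2l ?sqr_ge0//.
    by rewrite -[leRHS]real_normK ?num_real// lerXn2r ?nnegrE ?(ltW r0)// y0r.
  by rewrite expr0n mulr0.
- move=> j jN; rewrite acceleration_initial /f /interior; case: ifPn => [jI|_].
    rewrite exprMn mulrC ler_wpM2r ?sqr_ge0//.
    have [? [_ _ <- _ _]] := ypdP j jI.
    exact: (initial_value_le T K N yp ypd T0 K0 diff_on_solution within_solution_derivative).
  by rewrite expr0n mulr0.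
- exact: diff_on_integral.
- by rewrite set_itv1 Rintegral_set1 mulr0.
- by move=> j _; exact: diff_on_integral.
- by move=> j; rewrite set_itv1 Rintegral_set1.
- move=> j jN; case: (boolP (1 <= j <= N)%N) => jI.
    rewrite (@eq_Rintegral _ _ _ mu _ (fun t => ypd j t ^+ 2)) => [|t _].
      exact: (integral_derive_sqr_le T K N yp ypd K0 diff_on_solution within_solution_derivative).
    by rewrite /rho /interior jI.
  rewrite (@eq_Rintegral _ _ _ mu _ (fun=> 0)) => [|t _].
    by rewrite Rintegral_cst// mul0r sqr_ge0.
  by rewrite /rho /interior (negbTE jI) expr0n.
Qed.

Lemma flux_normE : normL2t T (derive1 (fun t => dminush N (z ^~ t) N.+1)) =
  (Num.sqrt (\int[mu]_(t in `[0, T]) flux2 t))%:E.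
Proof.
apply: normL2t_within => // [t tT|t]; last exact: sqr_ge0.
have df := diff_onM (diff_onB (diff_on_difference N.+1 (leqnn _))
  (diff_on_difference N (leqnSn _))) (diff_on_cst h^-1).
by rewrite [derive1 _ _](diff_on_derive1 df tT) mulr0 addr0.
Qed.

(** The factor [h] cancels the spacing in [dplush], which leaves the increments of [b]. *)
Lemma visc_normE : normL2t T (fun t => L2h0 N
    (fun j => h * dplush N (fun i => derive1n 2 (z i) t) j)) =
  (Num.sqrt (\int[mu]_(t in `[0, T]) visc2 t))%:E.
Proof.
have h0 := hstep_gt0 (R := R) N.
have v0 t : 0 <= visc2 t.
  by apply: mulr_ge0; [exact: ltW|apply: sumr_ge0 => j _; exact: sqr_ge0].
apply: normL2t_within => // t tT; rewrite /L2h0.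
have -> : \sum_(0 <= j < N.+1)
    `|h * dplush N (fun i => derive1n 2 (z i) t) j| ^+ 2 =
  \sum_(0 <= j < N.+1) (b j.+1 t - b j t) ^+ 2.
  apply: eq_big_nat => j /andP[_ jN]; rewrite real_normK ?num_real// /dplush.
  have d2 i : (i <= N.+1)%N -> derive1n 2 (z i) t = b i t.
    by move=> iN; exact: diff_on_derive2 (diff_on_difference i iN) (diff_on_velocity i iN) tT.
  by rewrite !d2 ?(ltnW jN)// mulrCA mulfV ?mulr1// hstep_neq0.
by rewrite sqr_sqrtr//; exact: v0.
Qed.

Lemma L2h_differenceE : L2h N (fun j => q j - p j) =
  Num.sqrt (h * \sum_(0 <= j < N.+1) f j ^+ 2).
Proof.
rewrite /L2h [in RHS]big_nat_recl// {1}/f /interior/= expr0n add0r big_add1/=.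
congr (Num.sqrt (_ * _)); apply: eq_big_nat => j /andP[_ jN].
by rewrite /f /interior jN real_normK ?num_real// -sqrrN opprB.
Qed.

End solutions.

(** * Choice of [kap] and [lam], and the estimate for solutions *)

Theorem theorem3p1 (R : realType) (m K r T : R)
  (hm : 0 < m) (hK : 0 < K) (hr : 0 < r) (hT : 1 < T) :
  exists C : R, 0 < C /\
  forall (N : nat) (p y0 y1 : nat -> R) (g : nat -> R -> R) (g0 g1 : R -> R)
         (yp : nat -> R -> R),
    Linfh N p <= m ->
    inL1L2h N T g -> inL2t T g0 -> inL2t T g1 ->
    is_solution N T p y0 y1 g g0 g1 yp ->
    (normH1Linfh N T yp <= K%:E)%E ->
    (forall j, (1 <= j <= N)%N -> r <= `|y0 j|) ->
  forall (q : nat -> R) (yq : nat -> R -> R),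
    Linfh N q <= m ->
    is_solution N T q y0 y1 g g0 g1 yq ->
    let z j t := yq j t - yp j t in
    let flux t := dminush N (z ^~ t) N.+1 in
    let visc t j := hstep R N * dplush N (fun i => derive1n 2 (z i) t) j in
    ((L2h N (fun j => (q j - p j)%R))%:E <=
       C%:E * normL2t T (derive1 flux) +
       C%:E * normL2t T (fun t => L2h0 N (visc t)))%E.
Proof.
have T0 : 0 < T by exact: lt_trans hT.
(* Chosen so that [kap T] is the midpoint of 1 and T: this gives [kap T > 1] together with
   [1/2 <= kap < 1]. *)
pose kap : R := (1 + T) / (2 * T).
have kapT : kap * T = (1 + T) / 2 by rewrite /kap; field; rewrite gt_eqF.
have k1 : kap < 1 by rewrite /kap ltr_pdivrMr ?mulr_gt0//; lra.
have k12 : 1 / 2 <= kap by rewrite /kap ler_pdivlMr ?mulr_gt0//; lra.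
have kT : 1 < kap * T by rewrite kapT; lra.
(* The constant of the energy estimate, with [B] taken from the trace inequality. It depends on [T],
   [m], [K] only, so [lam] and the final constant are independent of [N]. *)
pose M := expR ((m + 2) * T) * (((2 + T ^+ 2) * K ^+ 2 / T + K ^+ 2) / 2).
have M0 : 0 <= M.
  rewrite mulr_ge0 ?expR_ge0// divr_ge0// addr_ge0 ?sqr_ge0// divr_ge0 ?(ltW T0)//.
  by rewrite mulr_ge0 ?addr_ge0 ?sqr_ge0.
have [lam [l1 l2 l3 l4]] := exists_rate T m K r kap M kT k1 hr M0.
pose St := `|stability_constant T m K r kap lam|.
(* The square root turns the estimate on squares into one on norms; adding 1 makes the constant
   positive, and the absolute value in [St] spares a discussion of sign. *)
exists (Num.sqrt St + 1); split; first by rewrite ltr_wpDl ?sqrtr_ge0.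
move=> N p y0 y1 g g0 g1 yp _ _ _ _ Yp YpK y0r q yq qm Yq; cbv zeta.
have [ypd Hp] := solution_derivatives N T p y0 y1 g g0 g1 yp Yp.
have [yqd Hq] := solution_derivatives N T q y0 y1 g g0 g1 yq Yq.
rewrite (flux_normE N T T0 p q y0 y1 g g0 g1 yp yq ypd yqd Yp Yq Hp Hq).
rewrite (visc_normE N T T0 p q y0 y1 g g0 g1 yp yq ypd yqd Yp Yq Hp Hq).
rewrite L2h_differenceE -!EFinM -EFinD lee_fin.
have := stability_of_solutions N T T0 p q y0 y1 g g0 g1 yp yq ypd yqd Yp Yq Hp Hq
  m K r hm hK hr hT qm YpK y0r kap lam k12 k1 l1 l2 l3 l4.
set X := hstep R N * _; set I1 := \int[_]_(t in _) _; set I2 := \int[_]_(t in _) _.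
move=> XI.
have I10 : 0 <= I1 by apply: Rintegral_ge0 => t _; exact: sqr_ge0.
have I20 : 0 <= I2.
  apply: Rintegral_ge0 => t _; apply: mulr_ge0; first exact: ltW (hstep_gt0 N).
  by apply: sumr_ge0 => j _; exact: sqr_ge0.
have {}XI : X <= St * (I1 + I2).
  by apply: (le_trans XI); rewrite ler_wpM2r ?addr_ge0// ler_norm.
have sqrtD : Num.sqrt (I1 + I2) <= Num.sqrt I1 + Num.sqrt I2.
  rewrite -[leRHS]ger0_norm ?addr_ge0 ?sqrtr_ge0// -sqrtr_sqr ler_wsqrtr//.
  by rewrite sqrrD !sqr_sqrtr// addrAC lerDl mulrn_wge0// mulr_ge0 ?sqrtr_ge0.
apply: (@le_trans _ _ (Num.sqrt St * Num.sqrt (I1 + I2))).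
  by rewrite -sqrtrM ?normr_ge0// ler_wsqrtr.
rewrite -mulrDr; apply: ler_pM; rewrite ?sqrtr_ge0//.
by rewrite lerDl.
Qed.
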